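(* Let $q$ be a non-zero complex number which is not a root of unity and let $U^+=U_q^+(B_2)$. Let $\mathrm{Aut}(U^+)$ be the group of algebra automorphisms of $U^+$ and let $\mathrm{Aut}_z(U^+)$ be the subgroup of those automorphisms $\sigma$ with $\sigma(\langle z\rangle)=\langle z\rangle$. Then $\mathrm{Aut}_z(U^+)=\mathrm{Aut}(U^+)$.
   Context: $U^+=U_q^+(B_2)$ is the unital associative $\mathbb{C}$-algebra generated by $e_1,e_2$ subject to the quantum Serre relations $e_1^2e_2-(q^2+q^{-2})e_1e_2e_1+e_2e_1^2=0$ and $e_2^3e_1-(q^2+1+q^{-2})e_2^2e_1e_2+(q^2+1+q^{-2})e_2e_1e_2^2-e_1e_2^3=0$. Set $e_3=e_1e_2-q^2e_2e_1$ and $z=e_2e_3-q^2e_3e_2$; $z$ is a central element of $U^+$. $\langle z\rangle$ is the two-sided ideal of $U^+$ generated by $z$. Automorphisms are $\mathbb{C}$-algebra automorphisms. *)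

(* Defs.v *)
From HB Require Import structures.
From mathcomp Require Import all_boot all_order all_algebra.
From mathcomp Require Import boolp classical_sets.
From mathcomp.multinomials Require Import monalg.

Set Implicit Arguments.
Unset Strict Implicit.
Unset Printing Implicit Defensive.

Import GRing.Theory.
Local Open Scope classical_set_scope.
Local Open Scope ring_scope.
Local Open Scope quotient_scope.

Section Ideals.
Variable A : nzRingType.
Implicit Types (I S : set A) (a b x y : A).

Definition two_sided_ideal I : Prop :=
  [/\ I 0, (forall x y, I x -> I y -> I (x + y)),
      (forall a x, I x -> I (a * x)) & (forall a x, I x -> I (x * a))].

Definition ideal_gen S : set A := smallest two_sided_ideal S.

Lemma ideal_gen_ideal S : two_sided_ideal (ideal_gen S).
Proof.
split.
- by move=> I [[]].
- move=> x y Ix Iy I [II SI]; case: (II) => _ ID _ _.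
  by apply: ID; [exact: Ix | exact: Iy].
- by move=> a x Ix I [II SI]; case: (II) => _ _ IM _; apply: IM; exact: Ix.
- by move=> a x Ix I [II SI]; case: (II) => _ _ _ IM; apply: IM; exact: Ix.
Qed.

Lemma ideal_gen_sub S : S `<=` ideal_gen S.
Proof. exact: sub_gen_smallest. Qed.

Definition ideal_pred S : {pred A} := fun x => `[< ideal_gen S x >].

Lemma ideal_predP S x : reflect (ideal_gen S x) (x \in ideal_pred S).
Proof. exact: asboolP. Qed.

Lemma ideal_pred_zmod S : zmod_closed (ideal_pred S).
Proof.
have [I0 ID IM _] := ideal_gen_ideal S.
split=> [|x y /ideal_predP Ix /ideal_predP Iy]; apply/ideal_predP => //.
by apply: ID => //; rewrite -mulN1r; exact: IM.
Qed.

HB.instance Definition _ S :=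
  GRing.isZmodClosed.Build A (ideal_pred S) (ideal_pred_zmod S).

End Ideals.

Section QuantumB2.
Variables (K : fieldType) (q : K).

Section Elements.
Variables (A : lalgType K) (x1 x2 : A).

Definition serre12 : A :=
  x1 ^+ 2 * x2 - (q ^+ 2 + q ^- 2) *: (x1 * x2 * x1) + x2 * x1 ^+ 2.

Definition serre21 : A :=
  x2 ^+ 3 * x1 - (q ^+ 2 + 1 + q ^- 2) *: (x2 ^+ 2 * x1 * x2)
  + (q ^+ 2 + 1 + q ^- 2) *: (x2 * x1 * x2 ^+ 2) - x1 * x2 ^+ 3.

Section Kernel.
Variables (B : nzRingType) (f : A -> B).
Hypotheses (fD : {morph f : x y / x + y}) (fN : {morph f : x / - x})
  (fM : {morph f : x y / x * y}) (fZ : forall c x, f x = 0 -> f (c *: x) = 0)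
  (f1 : f x1 = 0) (f2 : f x2 = 0).

Lemma serre12_ker : f serre12 = 0.
Proof.
rewrite /serre12 !(fD, fN) fZ; last by rewrite fM f1 mulr0.
by rewrite !(fM, f1, f2) mulr0 mul0r subr0 addr0.
Qed.

Lemma serre21_ker : f serre21 = 0.
Proof.
rewrite /serre21 !(fD, fN) !fZ; first by rewrite !(fM, f1, f2) mulr0 mul0r !subr0 addr0.
  by rewrite !fM f1 mulr0 mul0r.
by rewrite fM f2 mulr0.
Qed.

End Kernel.

End Elements.

Lemma serre12_morph (A B : lalgType K) (f : {lrmorphism A -> B}) x1 x2 :
  f (serre12 x1 x2) = serre12 (f x1) (f x2).
Proof.
have fZ c a : f (c *: a) = c *: f a by exact: linearZZ.
by rewrite /serre12 rmorphD rmorphB /= fZ !rmorphM.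
Qed.

Lemma serre21_morph (A B : lalgType K) (f : {lrmorphism A -> B}) x1 x2 :
  f (serre21 x1 x2) = serre21 (f x1) (f x2).
Proof.
have fZ c a : f (c *: a) = c *: f a by exact: linearZZ.
by rewrite /serre21 rmorphB rmorphD rmorphB /= !fZ !rmorphM.
Qed.

(* The letters of the free monoid are [false] for e_1 and [true] for e_2. *)
Definition freeB2 := {malg K[{fmonom bool}]}.

HB.instance Definition _ := GRing.Lalgebra.on freeB2.

Definition free1 : freeB2 := << fmu false >>.
Definition free2 : freeB2 := << fmu true >>.

Definition serreB2 : set freeB2 :=
  [set serre12 free1 free2; serre21 free1 free2].

Record Uplus := ToUplus { ofUplus : Quotient.quot (ideal_pred serreB2) }.

HB.instance Definition _ := [isNew for ofUplus].
HB.instance Definition _ := [Choice of Uplus by <:].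

End QuantumB2.

Arguments free1 {K}.
Arguments free2 {K}.

(* The projection, the generators and the operations are locked: otherwise    *)
(* unification unfolds the quotient and the free algebra, and diverges.       *)
HB.lock Definition piU (K : fieldType) (q : K) (x : freeB2 K) : Uplus q :=
  ToUplus (\pi_(Quotient.quot (ideal_pred (serreB2 q))) x).

HB.lock Definition reprU (K : fieldType) (q : K) (u : Uplus q) : freeB2 K :=
  repr (ofUplus u).

HB.lock Definition zeroU (K : fieldType) (q : K) : Uplus q := piU q 0.

HB.lock Definition oppU (K : fieldType) (q : K) (u : Uplus q) : Uplus q :=
  piU q (- reprU u).

HB.lock Definition addU (K : fieldType) (q : K) (u v : Uplus q) : Uplus q :=
  piU q (reprU u + reprU v).

HB.lock Definition oneU (K : fieldType) (q : K) : Uplus q := piU q 1.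

HB.lock Definition mulU (K : fieldType) (q : K) (u v : Uplus q) : Uplus q :=
  piU q (reprU u * reprU v).

HB.lock Definition scaleU (K : fieldType) (q : K) (c : K) (u : Uplus q) :
  Uplus q := piU q (c *: reprU u).

HB.lock Definition e1 (K : fieldType) (q : K) : Uplus q := piU q free1.

HB.lock Definition e2 (K : fieldType) (q : K) : Uplus q := piU q free2.

Section UplusAlgebra.
Variables (K : fieldType) (q : K).

Local Notation freeB2 := (freeB2 K).
Local Notation serreB2 := (serreB2 q).
Local Notation Uplus := (Uplus q).
Local Notation piU := (piU q).
Local Notation reprU := (@reprU K q).
Local Notation zeroU := (zeroU q).
Local Notation oppU := (@oppU K q).
Local Notation addU := (@addU K q).
Local Notation oneU := (oneU q).
Local Notation mulU := (@mulU K q).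
Local Notation scaleU := (@scaleU K q).
Local Notation e1 := (e1 q).
Local Notation e2 := (e2 q).

Lemma reprUK : cancel reprU piU.
Proof. by case=> u; rewrite piU.unlock reprU.unlock reprK. Qed.

Lemma piU_eq (x y : freeB2) : piU x = piU y <-> ideal_gen serreB2 (x - y).
Proof.
rewrite piU.unlock; split=> [[e]|/ideal_predP I].
  by apply/ideal_predP; rewrite Quotient.idealrBE; apply/eqP.
by congr ToUplus; apply/eqP; rewrite -Quotient.idealrBE.
Qed.

Lemma piU_repr (x : freeB2) : ideal_gen serreB2 (reprU (piU x) - x).
Proof. by apply/piU_eq; rewrite reprUK. Qed.


Lemma addU_pi (x y : freeB2) : addU (piU x) (piU y) = piU (x + y).
Proof.
rewrite addU.unlock.
have [_ ID _ _] := ideal_gen_ideal serreB2.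
by apply/piU_eq; rewrite opprD addrACA; apply: ID; exact: piU_repr.
Qed.

Lemma oppU_pi (x : freeB2) : oppU (piU x) = piU (- x).
Proof.
rewrite oppU.unlock.
have [_ _ IL _] := ideal_gen_ideal serreB2.
by apply/piU_eq; rewrite -opprD -mulN1r; apply: IL; exact: piU_repr.
Qed.

Lemma mulU_pi (x y : freeB2) : mulU (piU x) (piU y) = piU (x * y).
Proof.
rewrite mulU.unlock.
have [_ ID IL IR] := ideal_gen_ideal serreB2.
apply/piU_eq; set x' := reprU _; set y' := reprU _.
rewrite -[x' * y'](subrK (x * y')) -mulrBl -addrA -mulrBr.
by apply: ID; [apply: IR | apply: IL]; exact: piU_repr.
Qed.

Lemma scaleU_pi c (x : freeB2) : scaleU c (piU x) = piU (c *: x).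
Proof.
rewrite scaleU.unlock.
have [_ _ IL _] := ideal_gen_ideal serreB2.
apply/piU_eq; rewrite -scalerBr -[_ - x]mul1r scalerAl.
by apply: IL; exact: piU_repr.
Qed.

Lemma addUA : associative addU.
Proof.
move=> u v w; rewrite -[u]reprUK -[v]reprUK -[w]reprUK.
by rewrite !addU_pi addrA.
Qed.

Lemma addUC : commutative addU.
Proof.
by move=> u v; rewrite -[u]reprUK -[v]reprUK !addU_pi addrC.
Qed.

Lemma add0U : left_id zeroU addU.
Proof. by move=> u; rewrite -[u]reprUK zeroU.unlock addU_pi add0r. Qed.

Lemma addNU : left_inverse zeroU oppU addU.
Proof. by move=> u; rewrite -[u]reprUK zeroU.unlock oppU_pi addU_pi addNr. Qed.

HB.instance Definition _ := GRing.isZmodule.Build Uplus addUA addUC add0U addNU.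

Lemma piUD (x y : freeB2) : piU (x + y) = piU x + piU y.
Proof. by rewrite -addU_pi. Qed.

Lemma piU0 : piU 0 = 0. Proof. by rewrite -[RHS]/zeroU zeroU.unlock. Qed.

Lemma piU1 : piU 1 = oneU. Proof. by rewrite oneU.unlock. Qed.

Lemma mulUA : associative mulU.
Proof.
move=> u v w; rewrite -[u]reprUK -[v]reprUK -[w]reprUK.
by rewrite !mulU_pi mulrA.
Qed.

Lemma mul1U : left_id oneU mulU.
Proof. by move=> u; rewrite -[u]reprUK -piU1 mulU_pi mul1r. Qed.

Lemma mulU1 : right_id oneU mulU.
Proof. by move=> u; rewrite -[u]reprUK -piU1 mulU_pi mulr1. Qed.

Lemma mulUDl : left_distributive mulU +%R.
Proof.
move=> u v w; rewrite -[u]reprUK -[v]reprUK -[w]reprUK.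
by rewrite -piUD !mulU_pi mulrDl piUD.
Qed.

Lemma mulUDr : right_distributive mulU +%R.
Proof.
move=> u v w; rewrite -[u]reprUK -[v]reprUK -[w]reprUK.
by rewrite -piUD !mulU_pi mulrDr piUD.
Qed.

(* Taking the constant term kills both Serre relations, so 1 survives. *)
Lemma oneU_neq0 : oneU != 0.
Proof.
apply/eqP => e; have : ideal_gen serreB2 (1 - 0).
  by apply/piU_eq; rewrite piU1 e piU0.
pose ct := @mcoeff {fmonom bool} K (@mone {fmonom bool}).
have ctD (x y : freeB2) : ct (x + y) = ct x + ct y by exact: raddfD.
have ctN (x : freeB2) : ct (- x) = - ct x by exact: raddfN.
have ctM (x y : freeB2) : ct (x * y) = ct x * ct y by exact: rmorphM.
have ctZ c (x : freeB2) : ct x = 0 -> ct (c *: x) = 0.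
  by move=> x0; rewrite /ct mcoeffZ -/(ct x) x0 mulr0.
have ctf i : ct << fmu i >> = 0.
  by rewrite /ct mcoeffU fmP fm1 fmuE.
have ct0 : ct 0 = 0 by exact: raddf0.
have ct1 : ct 1 = 1 by exact: rmorph1.
clearbody ct; rewrite subr0 => /(_ [set x | ct x = 0]) I1.
suff : ct 1 = 0 by move/eqP; rewrite ct1 oner_eq0.
apply: I1; split.
  split=> [|x y|a x|a x] //=.
  - by rewrite ctD => -> ->; rewrite addr0.
  - by rewrite ctM => ->; rewrite mulr0.
  - by rewrite ctM => ->; rewrite mul0r.
have ct1f : ct free1 = 0 by exact: ctf.
have ct2f : ct free2 = 0 by exact: ctf.
by move=> x [] ->; [apply: serre12_ker | apply: serre21_ker].
Qed.

HB.instance Definition _ := GRing.Zmodule_isNzRing.Build Uplus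
  mulUA mul1U mulU1 mulUDl mulUDr oneU_neq0.

Lemma scaleUA a b (u : Uplus) : scaleU a (scaleU b u) = scaleU (a * b) u.
Proof. by rewrite -[u]reprUK !scaleU_pi scalerA. Qed.

Lemma scale1U : left_id 1 scaleU.
Proof. by move=> u; rewrite -[u]reprUK scaleU_pi scale1r. Qed.

Lemma scaleUDr : right_distributive scaleU +%R.
Proof.
move=> a u v; rewrite -[u]reprUK -[v]reprUK.
by rewrite -piUD !scaleU_pi scalerDr piUD.
Qed.

Lemma scaleUDl u : {morph scaleU^~ u : a b / a + b}.
Proof. by move=> a b; rewrite -[u]reprUK !scaleU_pi scalerDl piUD. Qed.

HB.instance Definition _ := GRing.Zmodule_isLmodule.Build K Uplus
  scaleUA scale1U scaleUDr scaleUDl.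

Lemma scaleUAl (c : K) (u v : Uplus) : c *: (u * v) = (c *: u) * v.
Proof.
change (scaleU c (mulU u v) = mulU (scaleU c u) v).
rewrite -[u]reprUK -[v]reprUK.
by rewrite !(mulU_pi, scaleU_pi) scalerAl.
Qed.

HB.instance Definition _ := GRing.Lmodule_isLalgebra.Build K Uplus scaleUAl.

Lemma freeB2_scalerAr (c : K) (x y : freeB2) : c *: (x * y) = x * (c *: y).
Proof.
have cC : GRing.comm (c%:MP : freeB2) x.
  rewrite /GRing.comm mul_malgC malgM_def malgZ_def fgmulgU.
  by apply/eq_bigr => k _; rewrite mulm1 mulrC.
by rewrite -mul_malgC mulrA cC -mulrA mul_malgC.
Qed.

Lemma scaleUAr (c : K) (u v : Uplus) : c *: (u * v) = u * (c *: v).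
Proof.
change (scaleU c (mulU u v) = mulU u (scaleU c v)).
rewrite -[u]reprUK -[v]reprUK.
by rewrite !(mulU_pi, scaleU_pi) freeB2_scalerAr.
Qed.

HB.instance Definition _ := GRing.Lalgebra_isAlgebra.Build K Uplus scaleUAr.

Lemma piU_linear : linear piU.
Proof. by move=> c x y; rewrite piUD -scaleU_pi. Qed.

Lemma piU_monoid : monoid_morphism piU.
Proof. by split=> [|x y]; [exact: piU1 | rewrite -mulU_pi]. Qed.

HB.instance Definition _ := GRing.isLinear.Build K freeB2 Uplus *:%R piU piU_linear.
HB.instance Definition _ :=
  GRing.isMonoidMorphism.Build freeB2 Uplus piU piU_monoid.

Definition e3 : Uplus := e1 * e2 - q ^+ 2 *: (e2 * e1).
Definition z : Uplus := e2 * e3 - q ^+ 2 *: (e3 * e2).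

Lemma serre12U : serre12 q e1 e2 = 0.
Proof.
have : piU (serre12 q free1 free2) = piU 0.
  by apply/piU_eq; rewrite subr0; apply: ideal_gen_sub; left.
by rewrite serre12_morph e1.unlock e2.unlock raddf0.
Qed.

Lemma serre21U : serre21 q e1 e2 = 0.
Proof.
have : piU (serre21 q free1 free2) = piU 0.
  by apply/piU_eq; rewrite subr0; apply: ideal_gen_sub; right.
by rewrite serre21_morph e1.unlock e2.unlock raddf0.
Qed.

End UplusAlgebra.

Arguments e1 {K q}.
Arguments e2 {K q}.
Arguments e3 {K q}.
Arguments z {K q}.

Section Automorphisms.
Variables (K : fieldType) (A : algType K).

Definition algAut : set (A -> A) :=
  [set s : A -> A | bijective s /\ exists f : {lrmorphism A -> A}, s = f :> (A -> A)].

Definition algAut_stab (I : set A) : set (A -> A) :=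
  [set s : A -> A | algAut s /\ s @` I = I].

Lemma algAut_id : algAut id.
Proof. by split; [exists id | exists idfun]. Qed.

Lemma algAut_comp s t : algAut s -> algAut t -> algAut (s \o t).
Proof.
move=> [bs [f sf]] [bt [g tg]]; split; first exact: bij_comp bs bt.
by exists (f \o g : {lrmorphism A -> A}); rewrite sf tg.
Qed.

Lemma algAut_inv s t : algAut s -> cancel s t -> cancel t s -> algAut t.
Proof.
move=> [bs [f sf]] sK tK; split; first by exists s.
have inj : injective s by exact: can_inj sK.
have tL : linear t.
  by move=> c x y; apply: inj; rewrite tK sf linearP /= -sf !tK.
have tM : monoid_morphism t.
  split=> [|x y]; apply: inj; rewrite tK sf ?rmorph1 //.
  by rewrite rmorphM /= -sf !tK.
pose L := GRing.isLinear.Build K A A *:%R t tL.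
pose M := GRing.isMonoidMorphism.Build A A t tM.
pose T : {lrmorphism A -> A} := HB.pack t L M.
by exists T.
Qed.

Lemma algAut_stab_id I : algAut_stab I id.
Proof. by split; [exact: algAut_id | rewrite image_id]. Qed.

Lemma algAut_stab_comp I s t :
  algAut_stab I s -> algAut_stab I t -> algAut_stab I (s \o t).
Proof.
move=> [As sI] [At tI]; split; first exact: algAut_comp.
by rewrite -image_comp tI sI.
Qed.

Lemma algAut_stab_inv I s t :
  algAut_stab I s -> cancel s t -> cancel t s -> algAut_stab I t.
Proof.
move=> [As sI] sK tK; split; first exact: algAut_inv As sK tK.
rewrite -{1}sI image_comp; apply/seteqP; split=> x /=.
  by move=> [y Iy <-]; rewrite /= sK.
by move=> Ix; exists x => //=; rewrite sK.
Qed.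

End Automorphisms.

Arguments algAut {K} A.

Definition Aut_z (K : fieldType) (q : K) : set (Uplus q -> Uplus q) :=
  algAut_stab (ideal_gen [set (z : Uplus q)]).

Arguments Aut_z {K} q.

(* Main.v *)
(* Write Q = q^2. For scalars a, b the algebra U^+ acts on functions of a variable
   x by q-difference operators with coefficients Laurent in x: e_3 is the shift
   x -> x/Q, e_2 multiplies by (x - a)/(Q - 1) and shifts x -> Qx, and e_1 is
   x^-1 (b - Q^2/(Q+1) e_3^2). On it z acts as a, and a second central element
   z' = w e_3 + z e_1, with w in the span of e_2 e_1 and e_3, acts as b. By a PBW
   argument these representations are jointly faithful, hence the center of U^+
   is C[z, z'].

   Let s be an automorphism, s(z) = P(z, z'). The point is that P(a, b) != 0 when
   a != 0. Suppose P(a, b) = 0; then s(z') acts as a scalar c, and c != 0 because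
   z is a polynomial in s(z) and s(z') which vanishes at (0, 0), as every
   character kills z. So s(w) s(e_3) acts as c, and s(e_3), being invertible among
   q-difference operators, is a monomial; since no element of U^+ maps past the
   zero x = a of e_2, it is multiplication by some l x^m. The relations then force
   m = 1 or -1, s(e_1) and s(e_2) to be one-term operators with opposite shifts,
   and s(e_2) s(e_1) to vanish at two points x0 and -x0. But e_2 and e_3, which
   lie in the algebra generated by s(e_1) and s(e_2), connect all neighbouring
   points of a Q-orbit except at x = a, so that x0 = -x0.

   Hence P(., b) has no nonzero root, for any b. If P(0, .) were not zero, P would
   be a constant, which is absurd. So z divides P and s(z) lies in <z>. *)
From HB Require Import structures.
Require Import Defs.
From mathcomp Require Import all_boot all_order all_algebra.
From mathcomp Require Import boolp classical_sets reals complex.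
From mathcomp Require Import ring zify.
From mathcomp.multinomials Require Import monalg.

Set Implicit Arguments.
Unset Strict Implicit.
Unset Printing Implicit Defensive.

Import Order.TTheory GRing.Theory.
Local Open Scope classical_set_scope.
Local Open Scope ring_scope.

(** * Homomorphisms out of U^+ *)

Section UniversalProperty.
Variables (K : fieldType) (q : K) (B : algType K) (b1 b2 : B).

Definition word_eval (m : {fmonom bool}) : B :=
  \prod_(i <- (m : seq bool)) (if i then b2 else b1).

Lemma word_eval_mmorphism : mmorphism word_eval.
Proof.
split=> [m1 m2|]; rewrite /word_eval; first by rewrite fmM big_cat.
by rewrite fm1 big_nil.
Qed.

HB.instance Definition _ :=
  isMultiplicative.Build {fmonom bool} B word_eval word_eval_mmorphism.

Let free_eval : freeB2 K -> B := mmap (in_alg B) word_eval.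

Let free_evalM : monoid_morphism free_eval.
Proof.
have [M1 M2] : multiplicative free_eval.
  apply: commr_mmap_is_multiplicative => g m m' /=.
  by rewrite /GRing.comm mulr_algl mulr_algr.
by split.
Qed.

Let free_evalL : linear free_eval.
Proof.
by move=> c x y; rewrite /free_eval raddfD /= mmapZ /= mulr_algl.
Qed.

Let free_eval_fmu i : free_eval << fmu i >> = if i then b2 else b1.
Proof.
by rewrite /free_eval mmapU /= scale1r mul1r /word_eval fmU big_seq1.
Qed.

(** Evaluating noncommutative polynomials at [b1], [b2] kills the ideal of the relations, so the
    value on a class can be read off any representative. *)
Lemma Uplus_lift : serre12 q b1 b2 = 0 -> serre21 q b1 b2 = 0 ->
  exists f : {lrmorphism Uplus q -> B}, f e1 = b1 /\ f e2 = b2.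
Proof.
move=> s12 s21.
pose ML := GRing.isLinear.Build K (freeB2 K) B *:%R free_eval free_evalL.
pose MM := GRing.isMonoidMorphism.Build (freeB2 K) B free_eval free_evalM.
pose F : {lrmorphism freeB2 K -> B} := HB.pack free_eval ML MM.
have F1 : F free1 = b1 by exact: free_eval_fmu.
have F2 : F free2 = b2 by exact: free_eval_fmu.
clearbody F.
have FD u v : F (u + v) = F u + F v by exact: raddfD.
have FB u v : F (u - v) = F u - F v by exact: raddfB.
have FZ c u : F (c *: u) = c *: F u by exact: linearZZ.
have FM u v : F (u * v) = F u * F v by exact: rmorphM.
have F0 : F 0 = 0 by exact: raddf0.
have F12 : F (serre12 q free1 free2) = 0 by rewrite serre12_morph F1 F2.
have F21 : F (serre21 q free1 free2) = 0 by rewrite serre21_morph F1 F2.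
have FI x : ideal_gen (serreB2 q) x -> F x = 0.
  move=> /(_ [set x | F x = 0]); apply; split.
    split=> [//|u v u0 v0|a u u0|a u u0].
    - by change (F (u + v) = 0); rewrite FD (u0 : F u = 0) (v0 : F v = 0) addr0.
    - by change (F (a * u) = 0); rewrite FM (u0 : F u = 0) mulr0.
    - by change (F (u * a) = 0); rewrite FM (u0 : F u = 0) mul0r.
  by move=> u [] ->; [exact: F12 | exact: F21].
pose f (u : Uplus q) := F (reprU u).
have fpi x : f (piU q x) = F x.
  by have := FI _ (@piU_repr _ q x); rewrite FB => /subr0_eq.
have fL : linear f.
  move=> c u v; rewrite -[u]reprUK -[v]reprUK.
  have <- := @piU_linear _ q c (reprU u) (reprU v).
  by rewrite !fpi FD FZ.
have fM : monoid_morphism f.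
  have [p1 pM] := @piU_monoid _ q.
  split=> [|u v]; first by rewrite -p1 fpi rmorph1.
  by rewrite -[u]reprUK -[v]reprUK -pM !fpi FM.
pose L := GRing.isLinear.Build K (Uplus q) B *:%R f fL.
pose M := GRing.isMonoidMorphism.Build (Uplus q) B f fM.
pose g : {lrmorphism Uplus q -> B} := HB.pack f L M.
by exists g; split; rewrite /= ?e1.unlock ?e2.unlock fpi.
Qed.

End UniversalProperty.

(** Words span the free algebra, and each arises from 1 by left multiplications by letters. *)
Lemma Uplus_ind (K : fieldType) (q : K) (P : Uplus q -> Prop) :
    P 1 -> (forall u v, P u -> P v -> P (u + v)) ->
    (forall c u, P u -> P (c *: u)) ->
    (forall u, P u -> P (e1 * u)) -> (forall u, P u -> P (e2 * u)) ->
  forall u, P u.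
Proof.
move=> P1 PD PZ Pe1 Pe2 u; rewrite -[u]reprUK.
have [pi1 piM] := @piU_monoid _ q.
have P0 : P 0 by rewrite -(scale0r (1 : Uplus q)); exact: PZ.
have Pw m : P (piU q << m >>).
  case: m => s; elim: s => [|i s IH].
    have -> : FMonom [::] = @mone {fmonom bool} by apply/eqP; rewrite fmP fm1.
    by rewrite (_ : piU q _ = 1) //; exact: pi1.
  have -> : << FMonom (i :: s) >> = << fmu i >> * << FMonom s >> :> freeB2 K.
    have -> : FMonom (i :: s) = mmul (fmu i) (FMonom s).
      by apply/eqP; rewrite fmP fmM fmU.
    by rewrite malgM_def fgmulUU mulr1.
  rewrite (piM << fmu i >> _); move: Pe1 Pe2; rewrite e1.unlock e2.unlock.
  by move=> Pe1 Pe2; case: i; [exact: Pe2 | exact: Pe1].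
move: (reprU u) => x; rewrite [x]monalgE raddf_sum.
elim/big_ind: _ => //= m _.
have -> : << x@_m *g m >> = x@_m *: (<< m >> : freeB2 K).
  by apply/malgP => k; rewrite mcoeffZ !mcoeffU mulrnAr mulr1.
by rewrite linearZ; apply: PZ; exact: Pw.
Qed.

(** * The representations rho a b *)

Section Operators.
Variables (K : fieldType).

(** All functions are allowed, not only Laurent polynomials, so that functions supported at a single
    point can serve as tests. *)
Record oper := Oper {
  oper_fun :> (K -> K) -> K -> K;
  operP : forall c g h x, oper_fun (fun t => c * g t + h t) x
                          = c * oper_fun g x + oper_fun h x }.

HB.instance Definition _ := gen_eqMixin oper.
HB.instance Definition _ := gen_choiceMixin oper.

Lemma oper_ext (a b : oper) : (forall g x, a g x = b g x) -> a = b.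
Proof.
case: a b => [a aP] [b bP] /= ab.
have e : a = b by apply/funext => g; apply/funext => x.
by case: b / e bP {ab} => bP; congr Oper; exact: Prop_irrelevance.
Qed.

Program Definition oper0 := @Oper (fun _ _ => 0) _.
Next Obligation. by rewrite mulr0 addr0. Qed.
Program Definition oper1 := @Oper (fun g => g) _.
Program Definition operN (a : oper) := @Oper (fun g x => - a g x) _.
Next Obligation. by rewrite operP; ring. Qed.
Program Definition operD (a b : oper) := @Oper (fun g x => a g x + b g x) _.
Next Obligation. by rewrite !operP; ring. Qed.
Program Definition operZ (c : K) (a : oper) := @Oper (fun g x => c * a g x) _.
Next Obligation. by rewrite !operP; ring. Qed.
Program Definition operM (a b : oper) := @Oper (fun g => a (b g)) _.
Next Obligation.
by rewrite -operP; congr (oper_fun a _ _); apply/funext => t; exact: operP.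
Qed.

Lemma operDA : associative operD.
Proof. by move=> a b c; apply: oper_ext => g x /=; rewrite addrA. Qed.
Lemma operDC : commutative operD.
Proof. by move=> a b; apply: oper_ext => g x /=; rewrite addrC. Qed.
Lemma oper0D : left_id oper0 operD.
Proof. by move=> a; apply: oper_ext => g x /=; rewrite add0r. Qed.
Lemma operND : left_inverse oper0 operN operD.
Proof. by move=> a; apply: oper_ext => g x /=; rewrite addNr. Qed.

HB.instance Definition _ :=
  GRing.isZmodule.Build oper operDA operDC oper0D operND.

Lemma operMA : associative operM.
Proof. by move=> a b c; apply: oper_ext. Qed.
Lemma oper1M : left_id oper1 operM.
Proof. by move=> a; apply: oper_ext. Qed.
Lemma operM1 : right_id oper1 operM.
Proof. by move=> a; apply: oper_ext. Qed.
Lemma operMDl : left_distributive operM +%R.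
Proof. by move=> a b c; apply: oper_ext. Qed.
Lemma operMDr : right_distributive operM +%R.
Proof.
move=> a b c; apply: oper_ext => g x /=.
rewrite -[oper_fun a (b g) x]mul1r -operP; congr (oper_fun a _ _).
by apply/funext => t; rewrite mul1r.
Qed.
Lemma oper1_neq0 : oper1 != 0.
Proof.
apply/eqP => /(congr1 (fun a : oper => a (fun=> 1) 0)) /eqP.
by rewrite oner_eq0.
Qed.

HB.instance Definition _ := GRing.Zmodule_isNzRing.Build oper
  operMA oper1M operM1 operMDl operMDr oper1_neq0.

Lemma operZA c d (a : oper) : operZ c (operZ d a) = operZ (c * d) a.
Proof. by apply: oper_ext => g x /=; rewrite mulrA. Qed.
Lemma oper1Z : left_id 1 operZ.
Proof. by move=> a; apply: oper_ext => g x /=; rewrite mul1r. Qed.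
Lemma operZDr : right_distributive operZ +%R.
Proof. by move=> c a b; apply: oper_ext => g x /=; rewrite mulrDr. Qed.
Lemma operZDl a : {morph operZ^~ a : c d / c + d}.
Proof. by move=> c d; apply: oper_ext => g x /=; rewrite mulrDl. Qed.

HB.instance Definition _ := GRing.Zmodule_isLmodule.Build K oper
  operZA oper1Z operZDr operZDl.

Lemma operZAl c (a b : oper) : c *: (a * b) = c *: a * b.
Proof. by apply: oper_ext. Qed.

HB.instance Definition _ := GRing.Lmodule_isLalgebra.Build K oper operZAl.

Lemma oper_fun0 (a : oper) x : a (fun=> 0) x = 0.
Proof.
have := operP a (- 1) (fun=> 0) (fun=> 0) x.
rewrite (_ : (fun=> _) = (fun=> 0)); first by rewrite mulN1r addNr.
by apply/funext => t; rewrite mulr0 addr0.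
Qed.

Lemma operZAr c (a b : oper) : c *: (a * b) = a * (c *: b).
Proof.
apply: oper_ext => g x; change (c * a (b g) x = a (fun t => c * b g t) x).
rewrite -[LHS]addr0 -(oper_fun0 a x) -operP.
by congr (oper_fun a _ _); apply/funext => t; rewrite addr0.
Qed.

HB.instance Definition _ := GRing.Lalgebra_isAlgebra.Build K oper operZAr.

Lemma oper_addE (a b : oper) g x : (a + b) g x = a g x + b g x.
Proof. by []. Qed.
Lemma oper_oppE (a : oper) g x : (- a) g x = - a g x.
Proof. by []. Qed.
Lemma oper_scaleE c (a : oper) g x : (c *: a) g x = c * a g x.
Proof. by []. Qed.
Lemma oper_mulE (a b : oper) g x : (a * b) g x = a (b g) x.
Proof. by []. Qed.
Lemma oper_oneE g x : (1 : oper) g x = g x.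
Proof. by []. Qed.
Lemma oper_zeroE g x : (0 : oper) g x = 0.
Proof. by []. Qed.

Definition operE :=
  (oper_addE, oper_oppE, oper_scaleE, oper_mulE, oper_oneE, oper_zeroE).

End Operators.

(** * The Serre relations as q-commutation relations *)

Section QuantumIdentities.
Variables (K : fieldType) (q : K).
Hypothesis q_neq0 : q != 0.
Variables (A : algType K) (x1 x2 : A).

Local Notation Q := (q ^+ 2).

Definition qcomm (a b : A) : A := a * b - Q *: (b * a).

(* Coordinates along four words: turns an identity between noncommutative      *)
(* polynomials into identities between their coefficients, within reach of     *)
(* [field].                                                                    *)
Lemma lin4P (w1 w2 w3 w4 : A) : exists L : K -> K -> K -> K -> A,
  [/\ forall a b c d a' b' c' d', L a b c d + L a' b' c' d'
        = L (a + a') (b + b') (c + c') (d + d'),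
      forall k a b c d, k *: L a b c d = L (k * a) (k * b) (k * c) (k * d),
      forall a b c d, - L a b c d = L (- a) (- b) (- c) (- d)
    & [/\ w1 = L 1 0 0 0, w2 = L 0 1 0 0, w3 = L 0 0 1 0 & w4 = L 0 0 0 1]].
Proof.
exists (fun a b c d => a *: w1 + b *: w2 + c *: w3 + d *: w4).
split=> [a b c d a' b' c' d'|k a b c d|a b c d|].
- rewrite !scalerDl addrACA; congr (_ + _); rewrite addrACA; congr (_ + _).
  exact: addrACA.
- by rewrite !scalerDr !scalerA.
- by rewrite !scaleNr !opprD.
- by rewrite !scale0r !scale1r !addr0 !add0r.
Qed.

(** Turns the first Serre relation into the q-commutation of [e1] and [e3]. *)
Lemma serre12E :
  serre12 q x1 x2 = x1 * qcomm x1 x2 - Q^-1 *: (qcomm x1 x2 * x1).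
Proof.
rewrite /serre12 /qcomm expr2 !mulrBr !mulrBl -!scalerAl -!scalerAr !mulrA.
have [L [LD LZ LN]] := lin4P (x1 * x1 * x2) (x1 * x2 * x1) (x2 * x1 * x1) 0.
move=> [-> -> -> _]; rewrite !(LZ, LN, LD).
by congr L; field.
Qed.

(** Up to a nonzero factor, the second Serre relation is the commutation of [e2] with [z]. *)
Lemma serre21E (x3 := qcomm x1 x2) :
  x2 * qcomm x2 x3 - qcomm x2 x3 * x2 = - Q *: serre21 q x1 x2.
Proof.
rewrite /serre21 {}/x3 /qcomm !exprSr !expr0 !mul1r.
rewrite !(mulrBr, mulrBl, mulrDr, mulrDl, =^~scalerAl, =^~scalerAr, mulrA).
have [L [LD LZ LN]] := lin4P (x2 * x2 * x2 * x1) (x2 * x2 * x1 * x2)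
  (x2 * x1 * x2 * x2) (x1 * x2 * x2 * x2).
move=> [-> -> -> ->]; rewrite !(LZ, LN, LD).
by congr L; field.
Qed.

(** Moving [x1] to the right creates two terms [x3 ^+ 2], which cancel. For the generators this is
    the commutation of [e1] with [z]. *)
Lemma comm_qcomm x3 : x1 * x3 = Q^-1 *: (x3 * x1) ->
  x1 * x2 = x3 + Q *: (x2 * x1) -> x1 * qcomm x2 x3 = qcomm x2 x3 * x1.
Proof.
move=> h x12; have h' : x3 * x1 = Q *: (x1 * x3).
  by rewrite h scalerA mulfV ?scale1r // expf_neq0.
rewrite /qcomm mulrBr mulrBl -scalerAr -scalerAl !mulrA h x12.
rewrite -!scalerAl scalerA mulfV ?expf_neq0 // scale1r.
rewrite -(mulrA x3) x12 -(mulrA x2 x3) h' mulrDl mulrDr -!scalerAl -!scalerAr.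
by rewrite opprD addrACA subrr add0r !mulrA.
Qed.
End QuantumIdentities.

Section Representation.
Variables (K : fieldType) (q : K).
Hypotheses (q_neq0 : q != 0) (q2_neq1 : q ^+ 2 != 1)
  (q2_neqN1 : q ^+ 2 + 1 != 0).

Local Notation Q := (q ^+ 2).

Definition tr (n : int) (x : K) : K := Q ^ n * x.

Lemma trD m n x : tr m (tr n x) = tr (m + n) x.
Proof. by rewrite /tr mulrA expfzDr // expf_neq0. Qed.

Lemma tr0 x : tr 0 x = x.
Proof. by rewrite /tr expr0z mul1r. Qed.

(* The operators are chosen so that [e3] acts as g(x) |-> g(x/Q), [z] as a and *)
(* [z'] (defined below) as b. All this holds for x != 0 only: since 0^-1 = 0,  *)
(* evaluation at x = 0 gives a one-dimensional representation instead.         *)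
Definition rho2_fun (a : K) (g : K -> K) (x : K) : K :=
  (Q - 1)^-1 * (x - a) * g (tr 1 x).

Definition rho1_fun (b : K) (g : K -> K) (x : K) : K :=
  x^-1 * (b * g x - Q ^+ 2 / (Q + 1) * g (tr (- 2%:Z) x)).

Program Definition rho2 a := @Oper K (rho2_fun a) _.
Next Obligation. by rewrite /rho2_fun; ring. Qed.
Program Definition rho1 b := @Oper K (rho1_fun b) _.
Next Obligation. by rewrite /rho1_fun; ring. Qed.

Lemma tr1 x : tr 1 x = Q * x. Proof. by rewrite /tr expr1z. Qed.
Lemma trN1 x : tr (- 1%:Z) x = Q^-1 * x.
Proof. by rewrite /tr exprN1. Qed.
Lemma trN2 x : tr (- 2%:Z) x = Q^-1 ^+ 2 * x.
Proof. by rewrite /tr -exprnN exprVn. Qed.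
Lemma tr_0 n : tr n 0 = 0. Proof. by rewrite /tr mulr0. Qed.
Lemma tr_eq0 n x : (tr n x == 0) = (x == 0).
Proof. by rewrite /tr mulf_eq0 (negPf (expfz_neq0 _ _)) // expf_neq0. Qed.

Lemma rho1E b g x : rho1 b g x =
  x^-1 * (b * g x - Q ^+ 2 / (Q + 1) * g (tr (- 2%:Z) x)).
Proof. by []. Qed.

Lemma rho2E a g x : rho2 a g x = (Q - 1)^-1 * (x - a) * g (tr 1 x).
Proof. by []. Qed.

Lemma rho_qcomm a b g x :
  qcomm q (rho1 b) (rho2 a) g x = (x != 0)%:R * g (tr (- 1%:Z) x).
Proof.
rewrite /qcomm !(operE, rho1E, rho2E) !trD /=.
have [->|x0] := eqVneq x 0; first by rewrite !tr_0 invr0 /=; ring.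
rewrite mul1r (_ : (1 - 2%:Z) = - 1%:Z) //.
move: (g _) (g _) => g1 g2; rewrite tr1 trN2; field.
by rewrite x0 q_neq0 q2_neqN1 subr_eq0 q2_neq1.
Qed.

Lemma rho_serre12 a b : serre12 q (rho1 b) (rho2 a) = 0.
Proof.
rewrite serre12E //; apply: oper_ext => g x.
set c := qcomm _ _ _; rewrite -[LHS]/(rho1 b (c g) x - Q^-1 * c (rho1 b g) x).
rewrite rho1E !rho_qcomm rho1E.
have [->|x0] := eqVneq x 0; first by rewrite invr0 /=; ring.
rewrite mul1r !trD /= tr_eq0 x0 mul1r.
rewrite (_ : (- 1%:Z - 2%:Z) = - 2%:Z - 1%:Z) //.
move: (g _) (g _) => g1 g2; rewrite trN1; field.
by rewrite x0 q_neq0 q2_neqN1.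
Qed.

Lemma rho_z a b g x :
  qcomm q (rho2 a) (qcomm q (rho1 b) (rho2 a)) g x = (x != 0)%:R * a * g x.
Proof.
set c := qcomm q (rho1 _) _.
rewrite -[LHS]/(rho2 a (c g) x - Q * c (rho2 a g) x) rho2E !rho_qcomm rho2E.
have [->|x0] := eqVneq x 0; first by rewrite !tr_0 eqxx /=; ring.
rewrite tr_eq0 x0 !mul1r !trD tr0.
move: (g x) => g0; rewrite trN1; field.
by rewrite q_neq0 subr_eq0 q2_neq1.
Qed.

Lemma rho_serre21 a b : serre21 q (rho1 b) (rho2 a) = 0.
Proof.
have : - Q *: serre21 q (rho1 b) (rho2 a) = 0.
  rewrite -serre21E //; apply: oper_ext => g x; set c := qcomm _ _ _.
  rewrite -[LHS]/(rho2 a (c g) x - c (rho2 a g) x) rho2E !rho_z rho2E tr_eq0.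
  by rewrite oper_zeroE; have [->|x0] := eqVneq x 0; rewrite /=; ring.
move/eqP; rewrite scaler_eq0 oppr_eq0 (negPf (expf_neq0 _ q_neq0)).
by move/eqP.
Qed.

Lemma rho_exists a b : exists f : {lrmorphism Uplus q -> oper K},
  f e1 = rho1 b /\ f e2 = rho2 a.
Proof. exact: Uplus_lift (rho_serre12 a b) (rho_serre21 a b). Qed.

End Representation.

(** * Orbits of Q, and the action of e_3 and z *)

Section QuantumParameter.
Variables (K : fieldType) (q : K).
Hypotheses (q_neq0 : q != 0)
  (q_not_root : forall n : nat, (0 < n)%N -> q ^+ n != 1).

Local Notation Q := (q ^+ 2).

Lemma Q_neq0 : Q != 0. Proof. by rewrite expf_neq0. Qed.

Lemma Qexp_eq1 (n : int) : (Q ^ n == 1) = (n == 0).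
Proof.
apply/idP/eqP => [|->]; last by rewrite expr0z.
case: n => [[|n]|n] //.
  by rewrite -exprnP -exprM (negPf (q_not_root _)).
by rewrite NegzE -exprnN -exprM invr_eq1 (negPf (q_not_root _)).
Qed.

Lemma Q_neq1 : Q - 1 != 0.
Proof. by rewrite subr_eq0 q_not_root. Qed.

Lemma Q_neqN1 : Q + 1 != 0.
Proof.
apply/eqP => h; have /negP[] := q_not_root (isT : 0 < 4)%N.
have -> : q ^+ 4 = Q ^+ 2 by rewrite -exprM.
by rewrite -subr_eq0 -[1](expr1n _ 2) subr_sqr h mulr0.
Qed.

(** As Q is not a root of unity, the orbit of a nonzero point is free: integers label its points. *)
Lemma tr_eq m n x : x != 0 -> (tr q m x == tr q n x) = (m == n).
Proof.
move=> x0; have tn0 : tr q n x != 0 by rewrite tr_eq0.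
have -> : tr q m x = Q ^ (m - n) * tr q n x.
  by rewrite /tr mulrA -expfzDr ?subrK // Q_neq0.
rewrite -[X in _ == X]mul1r (inj_eq (mulIf tn0)) Qexp_eq1 subr_eq0.
by [].
Qed.

Lemma poly_eq0_powers (p : {poly K}) :
  (forall n : nat, p.[Q ^+ n] = 0) -> p = 0.
Proof.
move=> p0; apply: (@roots_geq_poly_eq0 _ _ [seq Q ^+ i | i <- iota 0 (size p)]).
- by apply/allP => _ /mapP[i _ ->]; apply/rootP/p0.
- rewrite map_inj_in_uniq ?iota_uniq // => i j _ _ /eqP.
  have := tr_eq i j (oner_neq0 K); rewrite /tr !mulr1 -!exprnP => ->.
  by rewrite eqz_nat => /eqP.
- by rewrite size_map size_iota.
Qed.

Lemma poly_eq0 (p : {poly K}) : (forall x, x != 0 -> p.[x] = 0) -> p = 0.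
Proof. by move=> p0; apply: poly_eq0_powers => n; rewrite p0 ?expf_neq0. Qed.

Lemma rho_sig a b :
  {f : {lrmorphism Uplus q -> oper K} | f e1 = rho1 q b /\ f e2 = rho2 q a}.
Proof.
apply: cid; apply: rho_exists => //; first by rewrite -subr_eq0 Q_neq1.
exact: Q_neqN1.
Qed.

Definition rho a b : {lrmorphism Uplus q -> oper K} := sval (rho_sig a b).

Implicit Types (u v w : Uplus q) (g : K -> K) (a b c x : K).

Lemma rho_e1 a b g x : rho a b e1 g x =
  x^-1 * (b * g x - Q ^+ 2 / (Q + 1) * g (tr q (- 2%:Z) x)).
Proof. by rewrite /rho; case: (rho_sig a b) => f /= [-> _]. Qed.

Lemma rho_e2 a b g x : rho a b e2 g x = (Q - 1)^-1 * (x - a) * g (tr q 1 x).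
Proof. by rewrite /rho; case: (rho_sig a b) => f /= [_ ->]. Qed.

Lemma rhoD a b u v g x : rho a b (u + v) g x = rho a b u g x + rho a b v g x.
Proof. by rewrite raddfD. Qed.

Lemma rhoN a b u g x : rho a b (- u) g x = - rho a b u g x.
Proof. by rewrite raddfN. Qed.

Lemma rhoZ a b c u g x : rho a b (c *: u) g x = c * rho a b u g x.
Proof. by rewrite linearZ. Qed.

Lemma rhoM a b u v g x : rho a b (u * v) g x = rho a b u (rho a b v g) x.
Proof. by rewrite rmorphM. Qed.

Lemma rho_1 a b g x : rho a b 1 g x = g x.
Proof. by rewrite rmorph1. Qed.

Lemma rho_0 a b g x : rho a b 0 g x = 0.
Proof. by rewrite raddf0. Qed.

Lemma e3E : e3 = qcomm q e1 e2 :> Uplus q. Proof. by []. Qed.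
Lemma zE : z = qcomm q e2 e3 :> Uplus q. Proof. by []. Qed.

Lemma rho_e3 a b g x : x != 0 -> rho a b e3 g x = g (tr q (- 1%:Z) x).
Proof.
move=> x0; rewrite e3E /qcomm rhoD rhoN rhoZ !rhoM !(rho_e1, rho_e2).
have := rho_qcomm q_neq0 _ Q_neqN1 a b g x; rewrite x0 mul1r => <- //.
by rewrite -subr_eq0 Q_neq1.
Qed.

Lemma rho_zE a b g x : x != 0 -> rho a b z g x = a * g x.
Proof.
move=> x0; rewrite zE /qcomm rhoD rhoN rhoZ !rhoM rho_e2 !rho_e3 ?rho_e2 //.
  by rewrite !trD // tr0 trN1; field; rewrite q_neq0 Q_neq1.
by rewrite tr_eq0.
Qed.

Lemma e1e3 : e1 * e3 = Q^-1 *: (e3 * e1) :> Uplus q.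
Proof. by apply/eqP; rewrite -subr_eq0 -serre12E // serre12U. Qed.

Lemma e3e1 : e3 * e1 = Q *: (e1 * e3) :> Uplus q.
Proof. by rewrite e1e3 scalerA mulfV ?scale1r // Q_neq0. Qed.

Lemma e2e1 : e2 * e1 = Q^-1 *: (e1 * e2) - Q^-1 *: e3 :> Uplus q.
Proof.
by rewrite /e3 -scalerBr opprB addrC subrK scalerA mulVf ?scale1r // Q_neq0.
Qed.

Lemma e3e2 : e3 * e2 = Q^-1 *: (e2 * e3) - Q^-1 *: z :> Uplus q.
Proof.
by rewrite /z -scalerBr opprB addrC subrK scalerA mulVf ?scale1r // Q_neq0.
Qed.

Lemma z_central u : z * u = u * z.
Proof.
have ze1 : z * e1 = e1 * z :> Uplus q.
  by rewrite zE -(comm_qcomm q_neq0 e1e3) // /e3 subrK.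
have ze2 : z * e2 = e2 * z :> Uplus q.
  apply/eqP; rewrite eq_sym -subr_eq0 zE e3E (serre21E q_neq0).
  by rewrite serre21U scaler0.
move: (z : Uplus q) ze1 ze2 => t te1 te2.
elim/Uplus_ind: u => [|u v tu tv|c u tu|u tu|u tu].
- by rewrite mulr1 mul1r.
- by rewrite mulrDr mulrDl tu tv.
- by rewrite -scalerAl -scalerAr tu.
- by rewrite mulrA te1 -!mulrA tu.
- by rewrite mulrA te2 -!mulrA tu.
Qed.

End QuantumParameter.

(** * The PBW basis and faithfulness *)

Section HornerSpan.
Variables (K : fieldType) (A : algType K).
Implicit Types (c d e u v : A) (P : A -> Prop).

Definition subspace P :=
  [/\ P 0, (forall u v, P u -> P v -> P (u + v))
    & (forall k u, P u -> P (k *: u))].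

(** Sums of e^i a_i with a_i in [P], in Horner form. Nesting this construction produces ordered
    monomials. *)
Inductive hspan e P : A -> Prop :=
| hspan_base a of P a : hspan e P a
| hspan_step a u of P a & hspan e P u : hspan e P (a + e * u).

Lemma hspan_subspace e P : subspace P -> subspace (hspan e P).
Proof.
move=> [P0 PD PZ]; split=> [|u v hu hv|k u].
- exact: hspan_base.
- elim: hu v hv => {u} [a Pa|a u Pa hu IH] v [b Pb|b w Pb hw].
  + by apply: hspan_base; exact: PD.
  + by rewrite addrA; apply: hspan_step => //; exact: PD.
  + by rewrite addrAC; apply: hspan_step => //; exact: PD.
  + by rewrite addrACA -mulrDr; apply: hspan_step; [exact: PD | exact: IH].
- elim=> {u} [a Pa|a u Pa hu IH]; first by apply: hspan_base; exact: PZ.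
  by rewrite scalerDr scalerAr; apply: hspan_step => //; exact: PZ.
Qed.

Lemma hspan_mul e P u : P 0 -> hspan e P u -> hspan e P (e * u).
Proof. by move=> P0 hu; rewrite -[e * u]add0r; exact: hspan_step. Qed.

(** The straightening step: [c] passes each [e] of the Horner form at the cost of a scalar and a
    remainder [r]. *)
Lemma hspan_commute c e r k P : subspace P ->
    c * e = k *: (e * c) + r ->
    (forall a, P a -> hspan e P (c * a)) ->
    (forall u, hspan e P u -> hspan e P (r * u)) ->
  forall u, hspan e P u -> hspan e P (c * u).
Proof.
move=> sP ce cP rP u; have [_ hD hZ] := hspan_subspace e sP.
have [P0 _ _] := sP.
elim=> {u} [a Pa|a u Pa hu IH]; first exact: cP.
rewrite mulrDr mulrA ce mulrDl -scalerAl -mulrA.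
apply: (hD); first exact: cP.
by apply: hD; [apply: hZ; exact: hspan_mul | exact: rP].
Qed.

Lemma hspan_sum e P u : hspan e P u ->
  exists s : seq A, (forall i, (i < size s)%N -> P s`_i) /\
    u = \sum_(i < size s) e ^+ i * s`_i.
Proof.
elim=> {u} [a Pa|a u Pa hu [s [sP ->]]].
  exists [:: a]; split; first by case=> [_|//]; exact: Pa.
  by rewrite big_ord_recl big_ord0 expr0 mul1r addr0.
exists (a :: s); split; first by case=> [_|i]; [exact: Pa | exact: sP].
rewrite big_ord_recl expr0 mul1r mulr_sumr; congr (_ + _).
by apply: eq_bigr => i _; rewrite mulrA -exprS.
Qed.

End HornerSpan.

Section PBW.
Variables (K : fieldType) (q : K).
Hypotheses (q_neq0 : q != 0)
  (q_not_root : forall n : nat, (0 < n)%N -> q ^+ n != 1).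

Local Notation Q := (q ^+ 2).
Local Notation rho := (rho q_neq0 q_not_root).
Implicit Types (u v w : Uplus q) (g : K -> K) (a b c x : K).

Definition zspan u := exists f : {poly K}, u = horner_alg (z : Uplus q) f.
Definition span3 : Uplus q -> Prop := hspan e3 zspan.
Definition span23 : Uplus q -> Prop := hspan e2 span3.
Definition span123 : Uplus q -> Prop := hspan e1 span23.

Lemma zspan_subspace : subspace zspan.
Proof.
split=> [|_ _ [f ->] [h ->]|k _ [f ->]].
- by exists 0; rewrite raddf0.
- by exists (f + h); rewrite raddfD.
- by exists (k%:P * f); rewrite rmorphM /= horner_algC mulr_algl.
Qed.

Let span3_sub : subspace span3 := hspan_subspace e3 zspan_subspace.
Let span23_sub : subspace span23 := hspan_subspace e2 span3_sub.
Let span123_sub : subspace span123 := hspan_subspace e1 span23_sub.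

Lemma z_commute e : (z : Uplus q) * e = 1 *: (e * z) + 0.
Proof. by rewrite scale1r addr0; exact: z_central. Qed.

Lemma zspan_z u : zspan u -> zspan (z * u).
Proof. by move=> [f ->]; exists ('X * f); rewrite rmorphM /= horner_algX. Qed.

Let mul0_span (P : Uplus q -> Prop) e : subspace P ->
  forall u, hspan e P u -> hspan e P (0 * u).
Proof.
by move=> sP u _; rewrite mul0r; have [] := hspan_subspace e sP.
Qed.

Lemma span3_z u : span3 u -> span3 (z * u).
Proof.
apply: (hspan_commute zspan_subspace (z_commute e3)) => [a Pa|].
  by apply: hspan_base; exact: zspan_z.
exact: mul0_span zspan_subspace.
Qed.

Lemma span23_z u : span23 u -> span23 (z * u).
Proof.
apply: (hspan_commute span3_sub (z_commute e2)) => [a Pa|].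
  by apply: hspan_base; exact: span3_z.
exact: mul0_span span3_sub.
Qed.

Lemma span23_e3 u : span23 u -> span23 (e3 * u).
Proof.
have [P0 _ _] := zspan_subspace.
apply: (hspan_commute span3_sub (e3e2 q_neq0)) => [a Pa|v hv].
  by apply: hspan_base; exact: hspan_mul.
rewrite -scaleNr -scalerAl; have [_ _ hZ] := span23_sub.
by apply: hZ; exact: span23_z.
Qed.

Lemma span123_e3 u : span123 u -> span123 (e3 * u).
Proof.
apply: (@hspan_commute _ _ _ _ 0 Q _ span23_sub) => [|a Pa|].
- by rewrite addr0; exact: e3e1.
- by apply: hspan_base; exact: span23_e3.
- exact: mul0_span span23_sub.
Qed.

Lemma span123_e2 u : span123 u -> span123 (e2 * u).
Proof.
have [P0 _ _] := span3_sub.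
apply: (hspan_commute span23_sub (e2e1 q_neq0)) => [a Pa|v hv].
  by apply: hspan_base; exact: hspan_mul.
rewrite -scaleNr -scalerAl; have [_ _ hZ] := span123_sub.
by apply: hZ; exact: span123_e3.
Qed.

(** The ordered monomials e1^i e2^j e3^k z^l span: their span contains 1 and is stable under left
    multiplication by both generators. *)
Lemma span123T u : span123 u.
Proof.
have [P0 hD hZ] := span123_sub.
elim/Uplus_ind: u => [|u v|c u|u hu|u].
- do 3!apply: hspan_base; exists 1; by rewrite rmorph1.
- exact: hD.
- exact: hZ.
- by apply: hspan_mul => //; have [] := span23_sub.
- exact: span123_e2.
Qed.

Lemma rho_zspan f a b g x : x != 0 ->
  rho a b (horner_alg z f) g x = f.[a] * g x.
Proof.
move=> x0; elim/poly_ind: f => [|f c IH].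
  by rewrite raddf0 rho_0 horner0 mul0r.
rewrite rmorphD rmorphM /= horner_algX horner_algC rhoD rhoM rhoZ rho_1.
rewrite !hornerE mulrDl; congr (_ + _).
by rewrite -rhoM -z_central // rhoM rho_zE // IH; ring.
Qed.

Lemma rho_span3_lower u a b g x : span3 u -> x != 0 ->
    (forall n : nat, g (tr q (- n%:Z) x) = 0) -> rho a b u g x = 0.
Proof.
move=> hu; elim: hu x => {u} [_ [f ->]|_ u [f ->] hu IH] x x0 g0.
  by rewrite rho_zspan // -[x](tr0 q) (g0 0) mulr0.
rewrite rhoD rho_zspan // rhoM rho_e3 // IH ?tr_eq0 //.
  by rewrite -[x in g x](tr0 q) (g0 0) mulr0 addr0.
by move=> n; rewrite trD // -opprD -PoszD addn1.
Qed.

(* [e3] shifts points strictly, so evaluating at the point where the test      *)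
(* function is supported isolates the lowest term.                             *)
Lemma span3_eq0 u (s : int) : span3 u ->
  (forall a b g, a != 0 -> rho a b u g (tr q s a) = 0) -> u = 0.
Proof.
have z0 f : (forall a, a != 0 -> f.[a] = 0) -> horner_alg z f = 0 :> Uplus q.
  by move=> /(poly_eq0 q_neq0 q_not_root) ->; rewrite raddf0.
move=> hu; elim: hu s => {u} [_ [f ->]|_ u [f ->] hu IH] s u0.
  apply: z0 => a a0; have := u0 a 0 (fun=> 1) a0.
  by rewrite rho_zspan ?tr_eq0 // mulr1.
have f0 : horner_alg z f = 0 :> Uplus q.
  apply: z0 => a a0; have := u0 a 0 (fun t => (t == tr q s a)%:R) a0.
  rewrite rhoD rho_zspan ?tr_eq0 // rhoM rho_e3 ?tr_eq0 //.
  rewrite eqxx mulr1 (rho_span3_lower _ _ hu) ?tr_eq0 ?addr0 // => n.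
  rewrite !trD // (tr_eq q_neq0 q_not_root) //.
  by case: eqP => //; lia.
rewrite f0 add0r in u0 *.
(* Cancelling [e3] moves the evaluation point one step down, which is why [s] is arbitrary. *)
rewrite (IH (- 1%:Z + s)) ?mulr0 // => a b g a0.
by have := u0 a b g a0; rewrite rhoM rho_e3 ?tr_eq0 // trD.
Qed.

(* The factor x - a of [e2] vanishes at x = a, so this point only sees the     *)
(* terms without [e2]; the point a/Q then sees those with one [e2], etc.       *)
Lemma span23_eq0 u : span23 u ->
    (forall a b g (n : nat), a != 0 -> rho a b u g (tr q (- n%:Z) a) = 0) ->
  u = 0.
Proof.
elim=> {u} [u hu|c u hc hu IH] u0.
  by apply: (span3_eq0 (s := 0) hu) => a b g a0; exact: (u0 a b g 0%N).
have c0 : c = 0.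
  apply: (span3_eq0 (s := 0) hc) => a b g a0; have := u0 a b g 0%N a0.
  by rewrite oppr0 tr0 rhoD rhoM rho_e2 subrr mulr0 mul0r addr0.
rewrite {}c0 add0r in u0 *; rewrite IH ?mulr0 // => a b g n a0.
(* At a/Q^(n+1) the factor of [e2] is nonzero; it cancels and leaves [u] evaluated at a/Q^n. *)
have := u0 a b g n.+1 a0; rewrite rhoM rho_e2 trD //.
rewrite (_ : 1 + - n.+1%:Z = - n%:Z); last by lia.
move/eqP; rewrite mulf_eq0 => /orP[|/eqP //].
rewrite mulf_eq0 invr_eq0 (negPf (Q_neq1 q_not_root)) subr_eq0 /=.
by rewrite -[X in _ == X](tr0 q) (tr_eq q_neq0 q_not_root).
Qed.

Lemma rho_span3_indep u a b b' g x : span3 u -> x != 0 ->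
  rho a b u g x = rho a b' u g x.
Proof.
move=> hu; elim: hu x => {u} [_ [f ->]|_ u [f ->] hu IH] x x0.
  by rewrite !rho_zspan.
by rewrite !rhoD !rhoM !rho_zspan // !rho_e3 // IH // tr_eq0.
Qed.

Lemma rho_span23_indep u a b b' g x : span23 u -> x != 0 ->
  rho a b u g x = rho a b' u g x.
Proof.
move=> hu; elim: hu x => {u} [u hu|c u hc hu IH] x x0.
  exact: rho_span3_indep.
by rewrite !rhoD !rhoM !rho_e2 IH ?tr_eq0 // (rho_span3_indep a b b').
Qed.

(** The parameter [b] enters only through [e1], linearly, so the top coefficient in [b] isolates the
    highest power of [e1]. *)
Lemma rho_e1X_poly u a g (k : nat) x : span23 u -> x != 0 ->
  exists p : {poly K}, [/\ forall b, rho a b (e1 ^+ k * u) g x = p.[b],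
    (size p <= k.+1)%N & p`_k = x^-1 ^+ k * rho a 0 u g x].
Proof.
move=> hu; elim: k x => [|k IH] x x0.
  exists (rho a 0 u g x)%:P; split=> [b||].
  - by rewrite expr0 mul1r hornerC; exact: rho_span23_indep.
  - by rewrite (leq_trans (size_polyC_leq1 _)).
  - by rewrite coefC expr0 mul1r.
have [p [pE ps pk]] := IH _ x0.
have x'0 : tr q (- 2%:Z) x != 0 by rewrite tr_eq0.
have [p' [pE' ps' _]] := IH _ x'0.
exists (x^-1 *: (p * 'X - (Q ^+ 2 / (Q + 1)) *: p')); split=> [b||].
- by rewrite exprS -mulrA rhoM rho_e1 pE pE' !hornerE; ring.
- apply: leq_trans (size_scale_leq _ _) _.
  apply: leq_trans (size_polyD _ _) _; rewrite geq_max size_polyN.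
  rewrite (leq_trans (size_polyMleq _ _)) ?size_polyX ?addn2 //=.
  by apply: leq_trans (size_scale_leq _ _) _; rewrite (leq_trans ps').
- rewrite coefZ coefB coefMX /= pk coefZ (nth_default _ ps') mulr0 subr0.
  by rewrite exprS mulrA.
Qed.

(** Write [u] in powers of [e1]. The top coefficient in [b] shows that the last term [v] acts as 0
    at the points required by [span23_eq0], so [v] is 0 and the sum gets shorter. *)
Theorem rho_faithful u :
  (forall a b g x, a != 0 -> x != 0 -> rho a b u g x = 0) -> u = 0.
Proof.
have [s [sP ->]] := hspan_sum (span123T u).
have [n sn] := ubnP (size s); elim: n s sP sn => // n IHn s.
case/lastP: s => [|s v] sP sn u0; first by rewrite big_ord0.
have vP : span23 v.
  by have := sP (size s); rewrite nth_rcons ltnn eqxx size_rcons; apply.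
have {}sP i : (i < size s)%N -> span23 s`_i.
  move=> si; have := sP i; rewrite nth_rcons si size_rcons ltnS.
  by apply; exact: ltnW.
have sumE : \sum_(i < size (rcons s v)) e1 ^+ i * (rcons s v)`_i
    = \sum_(i < size s) e1 ^+ i * s`_i + e1 ^+ size s * v :> Uplus q.
  rewrite size_rcons big_ord_recr /= nth_rcons ltnn eqxx; congr (_ + _).
  by apply: eq_bigr => i _; rewrite nth_rcons ltn_ord.
have v0 : v = 0.
  apply: (span23_eq0 vP) => a b g m a0; set x := tr q _ _.
  have x0 : x != 0 by rewrite tr_eq0.
  have [p [pE ps pk]] := rho_e1X_poly a g (size s) vP x0.
  have [r [rE rs]] : exists r : {poly K},
      (forall b, rho a b (\sum_(i < size s) e1 ^+ i * s`_i) g x = r.[b])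
      /\ (size r <= size s)%N.
    elim/big_ind: _ => [|u1 u2 [r1 [E1 s1]] [r2 [E2 s2]]|i _].
    - by exists 0; rewrite size_poly0; split=> // c; rewrite rho_0 horner0.
    - exists (r1 + r2); split=> [c|]; first by rewrite rhoD E1 E2 hornerD.
      by rewrite (leq_trans (size_polyD _ _)) // geq_max s1.
    - have [r [E sr _]] := rho_e1X_poly a g i (sP i (ltn_ord i)) x0.
      by exists r; split=> //; exact: leq_trans sr (ltn_ord i).
  have : r + p = 0.
    apply: (poly_eq0 q_neq0 q_not_root) => c c0.
    by rewrite hornerD -rE -pE -rhoD -sumE; exact: u0.
  move/(congr1 (fun p : {poly K} => p`_(size s))); rewrite coefD coef0.
  rewrite (nth_default _ rs) add0r pk => /eqP.
  rewrite mulf_eq0 expf_eq0 invr_eq0 (negPf x0) andbF => /eqP <-.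
  exact: rho_span23_indep.
rewrite sumE v0 mulr0 addr0; apply: IHn => //.
  by move: sn; rewrite size_rcons !ltnS.
by move=> a b g x a0 x0; have := u0 a b g x a0 x0; rewrite sumE v0 mulr0 addr0.
Qed.

End PBW.

(** * Matrix coefficients and the center *)

Section Kernel.
Variables (K : fieldType) (q : K).
Hypotheses (q_neq0 : q != 0)
  (q_not_root : forall n : nat, (0 < n)%N -> q ^+ n != 1).

Local Notation Q := (q ^+ 2).
Local Notation rho := (rho q_neq0 q_not_root).
Implicit Types (u v w : Uplus q) (g h : K -> K) (a b c x : K).

(** Each generator shifts by at most two steps, so only finitely many points of the orbit of [x]
    matter. *)
Lemma rho_local a b u : exists N : nat, forall g x, x != 0 ->
  (forall i : int, (`|i| <= N)%N -> g (tr q i x) = 0) -> rho a b u g x = 0.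
Proof.
elim/Uplus_ind: u => [|u v [N hN] [M hM]|c u [N hN]|u [N hN]|u [N hN]].
- by exists 0 => g x x0 g0; rewrite rho_1 -[x](tr0 q) g0.
- exists (maxn N M) => g x x0 g0; rewrite rhoD hN ?hM ?addr0 // => i hi;
    by rewrite g0 // leq_max hi ?orbT.
- by exists N => g x x0 g0; rewrite rhoZ hN ?mulr0.
- exists (N + 2)%N => g x x0 g0; rewrite rhoM rho_e1 !hN ?tr_eq0 //.
  + by rewrite !mulr0 subr0 mulr0.
  + by move=> i hi; rewrite trD // g0 //; lia.
  + by move=> i hi; rewrite g0 //; lia.
- exists (N + 1)%N => g x x0 g0; rewrite rhoM rho_e2 !hN ?tr_eq0 ?mulr0 //.
  by move=> i hi; rewrite trD // g0 //; lia.
Qed.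

Lemma oper_sum (o : oper K) (n : nat) (c : 'I_n -> K) (h : 'I_n -> K -> K) x :
  o (fun t => \sum_(i < n) c i * h i t) x = \sum_(i < n) c i * o (h i) x.
Proof.
elim: n c h => [|n IH] c h.
  rewrite big_ord0 -[RHS](oper_fun0 o x); congr (oper_fun o _ _).
  by apply/funext => t; rewrite big_ord0.
rewrite big_ord_recl -IH -operP; congr (oper_fun o _ _).
by apply/funext => t; rewrite big_ord_recl.
Qed.

Definition delta (y : K) (t : K) : K := (t == y)%:R.

(* The coefficient of g(Q^i x) in (u g)(x). *)
Definition kcoef a b u (i : int) x := rho a b u (delta (tr q i x)) x.

(** On the window of shifts up to [M], [g] agrees with a combination of deltas, and locality ignores
    the difference. [M] may be enlarged so that the window contains a prescribed shift. *)
Lemma rho_expand a b u : exists N : nat, forall M : nat, (N <= M)%N ->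
  forall g x, x != 0 -> rho a b u g x =
  \sum_(i < M + M.+1) g (tr q (i%:Z - M%:Z) x) * kcoef a b u (i%:Z - M%:Z) x.
Proof.
have [N hN] := rho_local a b u; exists N => M NM g x x0.
rewrite /kcoef -oper_sum; set h := (X in _ = oper_fun _ X x).
apply/eqP; rewrite -subr_eq0; apply/eqP.
transitivity (rho a b u (fun t => (- 1) * h t + g t) x).
  by rewrite operP mulN1r addrC.
apply: hN => // i hi; rewrite /h.
have iM : (absz (i + M%:Z)%R < M + M.+1)%N by lia.
rewrite (bigD1 (Ordinal iM)) //= big1 => [|j jn].
  rewrite (_ : (absz (i + M%:Z))%:Z - M%:Z = i); last by lia.
  by rewrite /delta eqxx mulr1 addr0 mulN1r addNr.
rewrite /delta (tr_eq q_neq0 q_not_root) //.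
case: eqP => [e|]; last by rewrite mulr0.
by case/eqP: jn; apply: val_inj => /=; lia.
Qed.

Lemma rho_single a b u g x (j : int) : x != 0 ->
    (forall i, i != j -> g (tr q i x) = 0 \/ kcoef a b u i x = 0) ->
  rho a b u g x = g (tr q j x) * kcoef a b u j x.
Proof.
move=> x0 gk; have [N hN] := rho_expand a b u.
rewrite (hN (maxn N (absz j)) (leq_maxl _ _)) //; set M := maxn _ _.
have jM' : (`|j| <= M)%N by rewrite leq_maxr.
have jM : (absz (j + M%:Z)%R < M + M.+1)%N by lia.
rewrite (bigD1 (Ordinal jM)) //= big1 => [|i ij].
  by rewrite (_ : (absz (j + M%:Z))%:Z - M%:Z = j) ?addr0 //; lia.
have [|->|->] := gk (i%:Z - M%:Z); rewrite ?mul0r ?mulr0 //.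
by apply: contraNneq ij => e; apply/eqP/val_inj => /=; lia.
Qed.

Lemma rho_congr a b u g h x : x != 0 -> (forall t, t != 0 -> g t = h t) ->
  rho a b u g x = rho a b u h x.
Proof.
move=> x0 gh; have [N hN] := rho_expand a b u.
rewrite !(hN N) //; apply: eq_bigr => i _; rewrite gh // tr_eq0 //.
Qed.

(** Laurent polynomial functions on the nonzero points; the value at 0 is unconstrained. *)
Definition laurent (f : K -> K) :=
  exists (n : nat) (p : {poly K}), forall x, x != 0 -> x ^+ n * f x = p.[x].

Lemma laurent_congr f g :
  (forall x, x != 0 -> f x = g x) -> laurent f -> laurent g.
Proof. by move=> fg [n [p E]]; exists n, p => x x0; rewrite -fg // E. Qed.

Lemma laurentD f g : laurent f -> laurent g -> laurent (fun x => f x + g x).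
Proof.
move=> [n [p E]] [m [r F]]; exists (n + m)%N, ('X^m * p + 'X^n * r) => x x0.
rewrite hornerD !hornerM !hornerXn -E // -F // exprD.
by move: (x ^+ n) (x ^+ m) => s t; ring.
Qed.

Lemma laurentM f g : laurent f -> laurent g -> laurent (fun x => f x * g x).
Proof.
move=> [n [p E]] [m [r F]]; exists (n + m)%N, (p * r) => x x0.
by rewrite hornerM -E // -F // exprD mulrACA.
Qed.

Lemma laurent_poly (p : {poly K}) : laurent (fun x => p.[x]).
Proof. by exists 0, p => x _; rewrite expr0 mul1r. Qed.

Lemma laurentC c : laurent (fun=> c).
Proof. by apply: laurent_congr (laurent_poly c%:P) => x _; rewrite hornerC. Qed.

Lemma laurentV : laurent (fun x => x^-1).
Proof. by exists 1%N, 1 => x x0; rewrite expr1 hornerC mulfV. Qed.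

Lemma laurent_tr f (n : int) : laurent f -> laurent (fun x => f (tr q n x)).
Proof.
move=> [m [p E]]; exists m, ((Q ^ n) ^- m *: (p \Po (Q ^ n *: 'X))) => x x0.
rewrite hornerZ horner_comp !hornerE -E ?tr_eq0 //.
rewrite -/(tr q n x) /tr exprMn.
by rewrite !mulrA mulVf ?mul1r // expf_neq0 // expfz_neq0 // expf_neq0.
Qed.

Lemma laurent_kcoef a b u i : laurent (kcoef a b u i).
Proof.
elim/Uplus_ind: u i => [|u v hu hv|c u hu|u hu|u hu] i.
- apply: laurent_congr (laurentC (i == 0)%:R) => x x0.
  by rewrite /kcoef rho_1 /delta -[x in RHS](tr0 q) trD // addr0
    (tr_eq q_neq0 q_not_root) // eq_sym.
- by apply: laurent_congr (laurentD (hu i) (hv i)) => x _; rewrite /kcoef rhoD.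
- apply: laurent_congr (laurentM (laurentC c) (hu i)) => x _.
  by rewrite /kcoef rhoZ.
- have h1 := laurentM (laurentC b) (hu i).
  have h2 := laurentM (laurentC (- (Q ^+ 2 / (Q + 1))))
               (laurent_tr (- 2%:Z) (hu (i + 2))).
  apply: laurent_congr (laurentM laurentV (laurentD h1 h2)) => x x0.
  by rewrite /kcoef rhoM rho_e1 trD // addrK mulNr.
- have h1 := laurent_poly ((Q - 1)^-1 *: ('X - a%:P)).
  apply: laurent_congr (laurentM h1 (laurent_tr 1 (hu (i - 1)))) => x x0.
  by rewrite /kcoef rhoM rho_e2 trD // subrK !hornerE.
Qed.

Lemma rho_poly2 u g x :
  exists P : {poly {poly K}}, forall a b, rho a b u g x = P.[a%:P].[b].
Proof.
elim/Uplus_ind: u x => [|u v hu hv|c u hu|u hu|u hu] x.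
- by exists (g x)%:P%:P => a b; rewrite rho_1 !hornerC.
- have [P EP] := hu x; have [R ER] := hv x; exists (P + R) => a b.
  by rewrite rhoD EP ER !hornerD.
- have [P EP] := hu x; exists (c%:P *: P) => a b.
  by rewrite rhoZ EP hornerZ hornerM hornerC.
- have [P EP] := hu x; have [R ER] := hu (tr q (- 2%:Z) x).
  exists ((x^-1)%:P *: ('X *: P - (Q ^+ 2 / (Q + 1))%:P *: R)) => a b.
  rewrite rhoM rho_e1 EP ER.
  by rewrite !(hornerZ, hornerM, hornerD, hornerN, hornerC, hornerX).
- have [P EP] := hu (tr q 1 x).
  exists (((Q - 1)^-1)%:P *: ((x%:P%:P - 'X) * P)) => a b.
  rewrite rhoM rho_e2 EP.
  by rewrite !(hornerZ, hornerM, hornerD, hornerN, hornerC, hornerX) mulrA.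
Qed.

Definition scalar a b u (s : K) :=
  forall g x, x != 0 -> rho a b u g x = s * g x.

(** The element [e2 * e3] is diagonal with values (x - a)/(Q - 1), distinct at distinct points, so
    [u] is diagonal as well. Commutation with [e3] makes its diagonal coefficient constant on the
    powers of Q; being Laurent, it is constant. *)
Lemma rho_central u : (forall v, u * v = v * u) ->
  exists P : {poly {poly K}}, forall a b, scalar a b u P.[a%:P].[b].
Proof.
move=> uC; have [P EP] := rho_poly2 u (fun=> 1) 1.
exists P => a b; pose d := kcoef a b u 0.
have e23 g x : x != 0 -> rho a b (e2 * e3) g x = (Q - 1)^-1 * (x - a) * g x.
  by move=> x0; rewrite rhoM rho_e2 rho_e3 ?tr_eq0 // trD // tr0.
have ker0 i x : x != 0 -> i != 0 -> kcoef a b u i x = 0.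
  move=> x0 i0.
  have := congr1 (fun v => rho a b v (delta (tr q i x)) x) (uC (e2 * e3)).
  rewrite [LHS]rhoM [RHS]rhoM e23 // -/(kcoef a b u i x).
  pose c := (Q - 1)^-1 * (tr q i x - a).
  rewrite (@rho_congr _ _ _ _ (fun t => c * delta (tr q i x) t + (fun=> 0) t)) //;
    last first.
    move=> t t0; rewrite e23 // /delta /c addr0.
    by case: eqP => [->|]; rewrite ?mulr0.
  rewrite operP -/(kcoef a b u i x).
  rewrite oper_fun0 addr0 => /eqP.
  rewrite -subr_eq0 -mulrBl mulf_eq0 => /orP[|/eqP //].
  rewrite /c -mulrBr mulf_eq0 invr_eq0 (negPf (Q_neq1 q_not_root)) /=.
  rewrite opprB addrA subrK subr_eq0 -[X in _ == X](tr0 q).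
  by rewrite (tr_eq q_neq0 q_not_root) // (negPf i0).
have rhoE g x : x != 0 -> rho a b u g x = d x * g x.
  move=> x0; rewrite (@rho_single _ _ _ _ _ 0) // ?tr0 1?mulrC //.
  by move=> i i0; right; exact: ker0.
have dQ x : x != 0 -> d (tr q (- 1%:Z) x) = d x.
  move=> x0; have := congr1 (fun v => rho a b v (fun=> 1) x) (uC e3).
  by rewrite !rhoM rhoE // rho_e3 // rho_e3 // rhoE ?tr_eq0 // !mulr1.
have dn (n : nat) : d (Q ^+ n) = d 1.
  elim: n => // n <-; rewrite -(dQ (Q ^+ n.+1)) ?expf_neq0 //.
    by rewrite trN1 (exprS Q n) mulrA mulVf ?mul1r // expf_neq0.
have [n [p pE]] := laurent_kcoef a b u 0.
have p0 : p - d 1 *: 'X^n = 0.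
  apply: (poly_eq0_powers q_neq0 q_not_root) => k.
  by rewrite !hornerE -pE ?expf_neq0 // -/(d _) dn; ring.
move=> g x x0; rewrite rhoE // -EP rhoE ?oner_neq0 // mulr1; congr (_ * _).
have := pE x x0; rewrite (subr0_eq p0) !hornerE mulrC.
by apply: mulIf; rewrite expf_neq0.
Qed.

(* The outer variable of [P] is sent to [t], the inner one to [y]. *)
Definition eval2 (A : algType K) (y t : A) (P : {poly {poly K}}) : A :=
  (map_poly (horner_alg y) P).[t].

Lemma eval2_morph (A B : algType K) (f : {lrmorphism A -> B}) y t P :
  f (eval2 y t P) = eval2 (f y) (f t) P.
Proof.
rewrite /eval2 -horner_map -map_poly_comp; congr (_.[_]).
apply: eq_map_poly => p /=; elim/poly_ind: p => [|p c IH].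
  by rewrite !raddf0.
rewrite !(rmorphD, rmorphM) /= !horner_algX !horner_algC IH linearZ /=.
by rewrite rmorph1.
Qed.

Lemma eval2_step (A : algType K) (y t : A) P (c : {poly K}) :
  eval2 y t (P * 'X + c%:P) = eval2 y t P * t + horner_alg y c.
Proof.
rewrite /eval2 rmorphD rmorphM /= map_polyX map_polyC hornerD hornerC.
by rewrite hornerMX.
Qed.

Lemma scalarM a b u v s r :
  scalar a b u s -> scalar a b v r -> scalar a b (u * v) (s * r).
Proof. by move=> hu hv g x x0; rewrite rhoM hu // hv // mulrA. Qed.

Lemma scalarD a b u v s r :
  scalar a b u s -> scalar a b v r -> scalar a b (u + v) (s + r).
Proof. by move=> hu hv g x x0; rewrite rhoD hu // hv // mulrDl. Qed.

Lemma scalarC a b c : scalar a b (c%:A) c.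
Proof. by move=> g x x0; rewrite rhoZ rho_1. Qed.

Lemma scalar_eval2 a b y t s r P : scalar a b y s -> scalar a b t r ->
  scalar a b (eval2 y t P) P.[r%:P].[s].
Proof.
move=> hy ht; elim/poly_ind: P => [|P c IH].
  by move=> g x x0; rewrite /eval2 raddf0 !horner0 rho_0 mul0r.
rewrite eval2_step hornerMXaddC hornerD hornerM hornerC.
apply: scalarD; first exact: scalarM.
elim/poly_ind: c => [|p c IHp].
  by move=> g x x0; rewrite raddf0 horner0 rho_0 mul0r.
rewrite rmorphD rmorphM /= horner_algX horner_algC hornerMXaddC.
by apply: scalarD; [exact: scalarM | exact: scalarC].
Qed.

(** The coefficients make the terms g(x/Q^2) of [z'] cancel and leave b g(x). Where [z] is sent to
    0, this cofactor times [e3] is all that remains of [z']. *)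
Definition z'_cofactor : Uplus q :=
  (Q * (Q - 1)) *: (e2 * e1) + (Q ^+ 2 / (Q + 1)) *: e3.

Definition z' : Uplus q := z'_cofactor * e3 + z * e1.

Lemma scalar_z a b : scalar a b z a.
Proof. by move=> g x x0; rewrite rho_zE. Qed.

Lemma scalar_z' a b : scalar a b z' b.
Proof.
move=> g x x0; rewrite /z' rhoD [X in _ + X]rhoM rho_zE // rhoM /z'_cofactor.
rewrite rhoD !rhoZ rhoM.
rewrite rho_e2 !rho_e1 !(rho_e3, trD) ?tr_eq0 // tr0.
rewrite (_ : - 1%:Z - 2%:Z + 1 = - 2%:Z) // (_ : - 1%:Z - 1%:Z = - 2%:Z) //.
move: (g _) (g _) => g1 g2; rewrite tr1; field.
by rewrite x0 q_neq0 (Q_neqN1 q_not_root) (Q_neq1 q_not_root).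
Qed.

Lemma scalar_central u (P : K -> K -> K) :
  (forall a b, scalar a b u (P a b)) -> forall v, u * v = v * u.
Proof.
move=> uP v; apply/eqP; rewrite -subr_eq0; apply/eqP.
apply: (rho_faithful (q_neq0 := q_neq0) (q_not_root := q_not_root)).
move=> a b g x _ x0.
rewrite rhoD rhoN !rhoM uP //.
rewrite (@rho_congr _ _ v (rho a b u g)
  (fun t => P a b * g t + (fun=> 0) t)) //;
  last first.
  by move=> t t0; rewrite uP // addr0.
by rewrite operP oper_fun0 addr0 subrr.
Qed.

Lemma z'_central u : z' * u = u * z'.
Proof. by apply: scalar_central => a b; exact: scalar_z'. Qed.

Lemma scalar_inj u v (P : K -> K -> K) : (forall a b, scalar a b u (P a b)) ->
  (forall a b, scalar a b v (P a b)) -> u = v.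
Proof.
move=> uP vP; apply/eqP; rewrite -subr_eq0; apply/eqP.
apply: (rho_faithful (q_neq0 := q_neq0) (q_not_root := q_not_root)).
move=> a b g x _ x0.
by rewrite rhoD rhoN uP // vP // subrr.
Qed.

(** The central element and the evaluated polynomial act by the same scalars in every
    representation, so faithfulness identifies them. *)
Theorem center_eval2 u : (forall v, u * v = v * u) ->
  exists P : {poly {poly K}}, u = eval2 z' z P.
Proof.
move=> /rho_central[P uP]; exists P; apply: (scalar_inj uP) => a b.
by apply: scalar_eval2; [exact: scalar_z' | exact: scalar_z].
Qed.

End Kernel.

Lemma int_max (p : int -> Prop) (N : int) : (exists i, p i) ->
  (forall i, p i -> i <= N) -> exists m, p m /\ forall i, p i -> i <= m.
Proof.
move=> [i0 pi0] pN.
have ex : exists n : nat, `[< p (N - n%:Z) >].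
  exists (absz (N - i0)); apply/asboolP; have := pN _ pi0 => h.
  by rewrite (_ : N - _ = i0) //; lia.
case: (ex_minnP ex) => n /asboolP pn nmin; exists (N - n%:Z); split=> // i pi.
have iN := pN _ pi; have := nmin (absz (N - i)).
rewrite (_ : N - (absz (N - i))%:Z = i); last by lia.
by move=> /(_ (asboolT pi)) h; lia.
Qed.

Lemma int_min (p : int -> Prop) (N : int) : (exists i, p i) ->
  (forall i, p i -> N <= i) -> exists m, p m /\ forall i, p i -> m <= i.
Proof.
move=> [i0 pi0] pN.
have [||m [pm mmax]] := @int_max (fun i => p (- i)) (- N).
- by exists (- i0); rewrite opprK.
- by move=> i /pN; lia.
- exists (- m); split=> // i pi.
  by have := mmax (- i); rewrite opprK => /(_ pi); lia.
Qed.

(** * Automorphisms *)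

Section Homogeneous.
Variables (K : fieldType) (q : K).
Hypotheses (q_neq0 : q != 0)
  (q_not_root : forall n : nat, (0 < n)%N -> q ^+ n != 1).

Local Notation Q := (q ^+ 2).
Local Notation rho := (rho q_neq0 q_not_root).
Local Notation kcoef := (kcoef q_neq0 q_not_root).
Local Notation scalar := (scalar q_neq0 q_not_root).
Implicit Types (u v : Uplus q) (g h : K -> K) (a b c x : K).

Lemma kcoef_bound a b u : exists N : nat, forall (i : int) x, x != 0 ->
  (N < `|i|)%N -> kcoef a b u i x = 0.
Proof.
have [N hN] := rho_local q_neq0 q_not_root a b u; exists N => i x x0 iN.
apply: hN => // j hj; rewrite /delta (tr_eq q_neq0 q_not_root) //.
by case: eqP => // e; lia.
Qed.

Lemma kcoef_eq0 a b u : (forall i x, x != 0 -> kcoef a b u i x = 0) ->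
  scalar a b u 0.
Proof.
move=> u0 g x x0.
rewrite (@rho_single _ _ _ _ _ _ _ _ _ 0) // ?u0 ?mulr0 ?mul0r //.
by move=> i _; right; exact: u0.
Qed.

Lemma scalar_mull0 a b u v : scalar a b v 0 -> scalar a b (u * v) 0.
Proof.
move=> v0 g x x0; rewrite rhoM (@rho_congr _ _ _ _ _ _ _ _ (fun=> 0)) //.
  by rewrite oper_fun0 mul0r.
by move=> t t0; rewrite v0 // mul0r.
Qed.

Lemma scalar_mulr0 a b u v : scalar a b u 0 -> scalar a b (u * v) 0.
Proof. by move=> u0 g x x0; rewrite rhoM u0 // !mul0r. Qed.

Lemma scalar_uniq a b u c d : scalar a b u c -> scalar a b u d -> c = d.
Proof.
by move=> uc ud; have := uc (fun=> 1) 1 (oner_neq0 _);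
  rewrite ud ?oner_neq0 // !mulr1.
Qed.

Lemma scalar_kcoef a b u c i x : scalar a b u c -> x != 0 ->
  kcoef a b u i x = c * (i == 0)%:R.
Proof.
move=> uc x0; rewrite /kcoef uc // /delta -[X in X == _](tr0 q).
by rewrite (tr_eq q_neq0 q_not_root) // eq_sym.
Qed.

(** Coefficients of a product are convolutions over shifts; the hypothesis leaves only the term
    [i = m]. *)
Lemma kcoef_mul a b u v (m n : int) x : x != 0 ->
    (forall i : int, i != m ->
      kcoef a b u i x = 0 \/ kcoef a b v (m + n - i) (tr q i x) = 0) ->
  kcoef a b (u * v) (m + n) x = kcoef a b u m x * kcoef a b v n (tr q m x).
Proof.
move=> x0 uv; rewrite {1}/kcoef rhoM.
have kE i : rho a b v (delta (tr q (m + n) x)) (tr q i x)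
            = kcoef a b v (m + n - i) (tr q i x).
  by rewrite /kcoef trD // subrK.
rewrite (@rho_single _ _ _ _ _ _ _ _ _ m) //.
  by rewrite kE mulrC; congr (_ * kcoef _ _ _ _ _); lia.
by move=> i im; case: (uv i im) => e; [right | left; rewrite kE].
Qed.

(** Laurent polynomials have no zero divisors, and a polynomial vanishing at all nonzero points is
    0. *)
Lemma laurent_domain (f g : K -> K) : laurent f -> laurent g ->
    (exists2 x, x != 0 & f x != 0) -> (exists2 x, x != 0 & g x != 0) ->
  exists2 x, x != 0 & f x * g x != 0.
Proof.
move=> [n [p pE]] [m [r rE]] [x x0 fx] [y y0 gy].
have p0 : p != 0.
  apply/eqP => e; have := pE x x0; rewrite e horner0 => /eqP.
  by rewrite mulf_eq0 expf_eq0 (negPf x0) andbF (negPf fx).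
have r0 : r != 0.
  apply/eqP => e; have := rE y y0; rewrite e horner0 => /eqP.
  by rewrite mulf_eq0 expf_eq0 (negPf y0) andbF (negPf gy).
have [[t [t0 ft]]|nt] := pselect (exists t, t != 0 /\ f t * g t != 0).
  by exists t.
have /eqP : p * r = 0.
  apply: (poly_eq0 q_neq0 q_not_root) => t t0.
  have [e|e] := eqVneq (f t * g t) 0; last by case: nt; exists t.
  by rewrite hornerM -pE // -rE // mulrACA e mulr0.
by rewrite mulf_eq0 (negPf p0) (negPf r0).
Qed.

Definition supp a b u (i : int) := exists2 x : K, x != 0 & kcoef a b u i x != 0.

(* Applied to the largest shifts of [u] and [v], and to the smallest ones.     *)
Lemma kcoef_extreme_mul a b u v c (m n : int) : scalar a b (u * v) c ->
    supp a b u m ->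
    supp a b v n ->
    (forall i x, x != 0 -> i != m ->
      kcoef a b u i x = 0 \/ kcoef a b v (m + n - i) (tr q i x) = 0) ->
  m + n = 0.
Proof.
move=> uvc um [y y0 vy] uv; apply/eqP; apply/negP => /negP mn.
have vm : exists2 x, x != 0 & kcoef a b v n (tr q m x) != 0.
  by exists (tr q (- m) y); rewrite ?tr_eq0 // trD // addrN tr0.
have [x x0] := laurent_domain (laurent_kcoef q_neq0 q_not_root a b u m)
  (laurent_tr q_neq0 m (laurent_kcoef q_neq0 q_not_root a b v n)) um vm.
rewrite -(kcoef_mul x0) ?(scalar_kcoef _ uvc) // ?(negPf mn) ?mulr0 ?eqxx //.
by move=> i im; exact: uv.
Qed.

Definition homogeneous a b u (n : int) :=
  forall i x, x != 0 -> i != n -> kcoef a b u i x = 0.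

(** The largest shifts of [u] and [v] add up to 0, and so do the smallest ones. Hence the widths of
    the two supports add up to 0, and each support is a single shift. *)
Lemma invertible_homogeneous a b u v c : c != 0 -> scalar a b (u * v) c ->
  exists n : int, homogeneous a b u (- n) /\ homogeneous a b v n.
Proof.
move=> c0 uvc.
have nz t : ~ scalar a b t 0 -> exists i, supp a b t i.
  move=> tn0; case: (pselect (exists i, supp a b t i)) => // H.
  case: tn0; apply: kcoef_eq0 => i x x0; apply/eqP/negP => /negP k0.
  by apply: H; exists i, x.
have exu : exists i, supp a b u i.
  apply: nz => u0; have e := scalar_uniq (scalar_mulr0 v u0) uvc.
  by rewrite -e eqxx in c0.
have exv : exists i, supp a b v i.
  apply: nz => v0; have e := scalar_uniq (scalar_mull0 u v0) uvc.
  by rewrite -e eqxx in c0.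
have bnd t : exists N : nat, forall i, (supp a b t i) ->
    - N%:Z <= i <= N%:Z.
  have [N hN] := kcoef_bound a b t; exists N => i [x x0 /eqP k0].
  apply/andP; have : ~~ (N < `|i|)%N by apply/negP => /(hN i x x0).
  by move=> h; split; lia.
have [Nu hNu] := bnd u; have [Nv hNv] := bnd v.
have [mu [muP mumax]] := int_max exu (fun i hi => proj2 (andP (hNu i hi))).
have [mv [mvP mvmax]] := int_max exv (fun i hi => proj2 (andP (hNv i hi))).
have [lu [luP lumin]] := int_min exu (fun i hi => proj1 (andP (hNu i hi))).
have [lv [lvP lvmin]] := int_min exv (fun i hi => proj1 (andP (hNv i hi))).
have k0 t i x : x != 0 -> ~ (supp a b t i) -> kcoef a b t i x = 0.
  by move=> x0 H; apply/eqP/negP => /negP k0; apply: H; exists x.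
have top : mu + mv = 0.
  apply: (kcoef_extreme_mul uvc muP mvP) => i x x0 im.
  have [lt|gt] := boolP ((i : int) < mu); [right|left]; apply: k0; rewrite ?tr_eq0 //.
    by move/mvmax; lia.
  by move/mumax; move/eqP: im; lia.
have bot : lu + lv = 0.
  apply: (kcoef_extreme_mul uvc luP lvP) => i x x0 im.
  have [lt|gt] := boolP ((i : int) < lu); [left|right]; apply: k0; rewrite ?tr_eq0 //.
    by move/lumin; lia.
  by move/lvmin; move/eqP: im; lia.
have := mumax _ luP; have := mvmax _ lvP => h1 h2.
exists mv; split=> i x x0 /eqP im; apply: k0 => // hi.
  by have := mumax _ hi; have := lumin _ hi; lia.
by have := mvmax _ hi; have := lvmin _ hi; lia.
Qed.

Lemma rho_homogeneous a b u n g x : homogeneous a b u n -> x != 0 ->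
  rho a b u g x = g (tr q n x) * kcoef a b u n x.
Proof.
by move=> hu x0; apply: rho_single => // i im; right; exact: hu.
Qed.

(** By linearity, the values of [o g] on [S] depend only on those of [g] on [S]. *)
Definition preserves (S : K -> Prop) (o : oper K) :=
  forall g, (forall t, S t -> g t = 0) -> forall t, S t -> o g t = 0.

Lemma preserves_gen (S : K -> Prop) a b (s : {lrmorphism Uplus q -> Uplus q}) :
    preserves S (rho a b (s e1)) -> preserves S (rho a b (s e2)) ->
  forall u, preserves S (rho a b (s u)).
Proof.
move=> S1 S2; elim/Uplus_ind => [|u v hu hv|c u hu|u hu|u hu] g g0 t St.
- by rewrite rmorph1 rho_1 g0.
- by rewrite raddfD rhoD hu ?hv ?addr0.
- by rewrite linearZ rhoZ hu ?mulr0.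
- by rewrite rmorphM rhoM S1 // => y Sy; rewrite hu.
- by rewrite rmorphM rhoM S2 // => y Sy; rewrite hu.
Qed.

(* [e2] is the only generator with an upward shift, and it vanishes at x = a,  *)
(* so no element of U^+ can climb above a.                                     *)
Lemma kcoef_blocked a b u (n : int) : a != 0 -> 0 < n -> kcoef a b u n a = 0.
Proof.
move=> a0 n0; pose S t := exists k : nat, t = tr q (- k%:Z) a.
have S0 t : S t -> t != 0 by move=> [k ->]; rewrite tr_eq0.
have H : forall v, preserves S (rho a b v).
  apply: (preserves_gen (s := idfun)) => g g0 t St /=.
    rewrite rho_e1 !g0 ?mulr0 ?subr0 ?mulr0 //.
    by case: St => k ->; exists (k + 2)%N; rewrite trD //; congr tr; lia.
  case: St => [[|k] ->].
    by rewrite oppr0 tr0 rho_e2 subrr mulr0 mul0r.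
  rewrite rho_e2 g0 ?mulr0 //; exists k; rewrite trD //; congr tr; lia.
apply: (H u) => [t [k ->]|]; last by exists 0%N; rewrite oppr0 tr0.
by rewrite /delta (tr_eq q_neq0 q_not_root) //; case: eqP => // e; lia.
Qed.

(* If X and Y generate, then one of them climbs from y to Q y (as [e2] does,   *)
(* unless y = a) and one of them descends from Q y to y (as [e3] does).        *)
Lemma crossing a b (X Y : oper K) (up dn : K -> K) y : y != 0 ->
    (forall S, preserves S X -> preserves S Y ->
       forall u, preserves S (rho a b u)) ->
    (forall g x, x != 0 -> X g x = g (tr q 1 x) * up x) ->
    (forall g x, x != 0 -> Y g x = g (tr q (- 1%:Z) x) * dn x) ->
    up y * dn (tr q 1 y) = 0 ->
  y = a.
Proof.
move=> y0 gen XE YE /eqP; rewrite mulf_eq0 => /orP[/eqP up0|/eqP dn0].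
  (* The points from [y] downwards. If [X] does not climb from [y], then [S] is preserved by [X] and
     [Y], hence by [e2], whose factor at [y] must vanish. *)
  pose S t := exists k : nat, t = tr q (- k%:Z) y.
  have S0 t : S t -> t != 0 by move=> [k ->]; rewrite tr_eq0.
  have H : forall v, preserves S (rho a b v).
    apply: gen => g g0 t St; have t0 := S0 t St; last first.
      rewrite YE // g0 ?mul0r //; case: St => k ->; exists k.+1.
      by rewrite trD //; congr tr; lia.
    rewrite XE //; case: St => [[|k]] ->; first by rewrite oppr0 !tr0 up0 mulr0.
    by rewrite g0 ?mul0r //; exists k; rewrite trD //; congr tr; lia.
  have Sy : S y by exists 0%N; rewrite oppr0 tr0.
  have dS t : S t -> delta (tr q 1 y) t = 0.
    move=> [k ->]; rewrite /delta (tr_eq q_neq0 q_not_root) //.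
    by case: eqP => // e; lia.
  have /eqP := H e2 _ dS y Sy; rewrite rho_e2 /delta eqxx mulr1.
  by rewrite mulf_eq0 invr_eq0 (negPf (Q_neq1 q_not_root)) /= subr_eq0 => /eqP.
(* The points strictly above [y]. If [Y] does not descend to [y], then [e3] preserves [S], although
   it does descend from Qy to [y]. *)
pose S t := exists k : nat, t = tr q (1 + k%:Z) y.
have S0 t : S t -> t != 0 by move=> [k ->]; rewrite tr_eq0.
have H : forall v, preserves S (rho a b v).
  apply: gen => g g0 t St; have t0 := S0 t St.
    rewrite XE // g0 ?mul0r //; case: St => k ->; exists k.+1.
    by rewrite trD //; congr tr; lia.
  rewrite YE //; case: St => [[|k]] ->; first by rewrite addr0 dn0 mulr0.
  by rewrite g0 ?mul0r //; exists k; rewrite trD //; congr tr; lia.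
have Sy : S (tr q 1 y) by exists 0%N; rewrite addr0.
have dS t : S t -> delta y t = 0.
  move=> [k ->]; rewrite /delta -[X in _ == X](tr0 q).
  by rewrite (tr_eq q_neq0 q_not_root) //; case: eqP => // e; lia.
have /eqP := H e3 _ dS _ Sy; rewrite rho_e3 ?tr_eq0 // trD // addNr tr0.
by rewrite /delta eqxx oner_eq0.
Qed.

End Homogeneous.

(** * Excluding representations that kill the image of z only *)

Section SurjectionAtZero.
Variables (K : closedFieldType) (q : K).
Hypotheses (q_neq0 : q != 0)
  (q_not_root : forall n : nat, (0 < n)%N -> q ^+ n != 1)
  (two_neq0 : 2%:R != 0 :> K).

Local Notation Q := (q ^+ 2).
Local Notation rho := (rho q_neq0 q_not_root).
Local Notation kcoef := (kcoef q_neq0 q_not_root).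
Local Notation scalar := (scalar q_neq0 q_not_root).
Implicit Types (u v : Uplus q) (g h : K -> K) (a b c x : K).

Lemma closed_sqrt c : exists t : K, t ^+ 2 = c.
Proof.
have /closed_rootP[t] : size ('X^2 - c%:P : {poly K}) != 1%N.
  by rewrite size_XnsubC.
rewrite /root !hornerE subr_eq0 => /eqP; by exists t.
Qed.

(** Clearing denominators, two polynomials multiply to a multiple of a power of X, so each of them
    is a monomial. *)
Lemma laurent_unit f h c : c != 0 -> laurent f -> laurent h ->
    (forall x, x != 0 -> f x * h x = c) ->
  exists (l : K) (m : int), l != 0 /\ forall x, x != 0 -> f x = l * x ^ m.
Proof.
move=> c0 [n [p pE]] [m [r rE]] fh.
have pr : p * r = c *: 'X^(n + m).
  apply/eqP; rewrite -subr_eq0; apply/eqP.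
  apply: (poly_eq0 q_neq0 q_not_root) => x x0.
  rewrite hornerD hornerN hornerM hornerZ hornerXn -pE // -rE // mulrACA fh //.
  by rewrite exprD mulrC subrr.
have : p %| ('X - 0%:P) ^+ (n + m).
  rewrite subr0 -(@dvdpZr _ c) // -pr; exact: dvdp_mulr.
move/dvdp_exp_XsubCP => [k _]; rewrite subr0 => /eqpP [[s t] /= /andP[s0 t0] e].
exists (t / s), (k%:Z - n%:Z); split; first by rewrite mulf_neq0 ?invr_eq0.
move=> x x0; have := congr1 (fun p => p.[x]) e.
rewrite !hornerZ hornerXn -pE // => e'.
rewrite expfzDr // -exprnN -exprnP.
apply: (mulfI s0); apply: (mulfI (expf_neq0 n x0)).
rewrite mulrCA e'; field.
by rewrite s0 expf_neq0.
Qed.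

Lemma exprz_eq_int (m n : int) : Q ^ m = Q ^ n -> m = n.
Proof.
move/eqP; have := tr_eq q_neq0 q_not_root m n (oner_neq0 _).
by rewrite /tr !mulr1 => -> /eqP.
Qed.

(** Surjectivity enters through [gen]: a set preserved by the images of both generators is preserved
    by all of [U^+]. *)
Lemma no_surjection_at_zero (s : {lrmorphism Uplus q -> Uplus q}) a b c :
    (forall u, exists v, s v = u) -> a != 0 -> c != 0 ->
    scalar a b (s z) 0 -> scalar a b (s (z' q)) c -> False.
Proof.
move=> s_surj a0 c0 sz sz'.
have sM u v : s (u * v) = s u * s v by exact: rmorphM.
have sZ k u : s (k *: u) = k *: s u by exact: linearZZ.
have sD u v : s (u + v) = s u + s v by exact: raddfD.
have sB u v : s (u - v) = s u - s v by exact: raddfB.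
pose E1 := s e1; pose E2 := s e2; pose E3 := s e3; pose W := s (z'_cofactor q).
have h13 : E1 * E3 = Q^-1 *: (E3 * E1).
  by rewrite -!sM e1e3 // sZ.
have h23 : E2 * E3 = Q *: (E3 * E2) + s z.
  by rewrite -!sM -sZ -sD /z addrC subrK.
have h12 : E3 = E1 * E2 - Q *: (E2 * E1).
  by rewrite -!sM -sZ -sB.
have hW : W = (Q * (Q - 1)) *: (E2 * E1) + (Q ^+ 2 / (Q + 1)) *: E3.
  by rewrite /W /z'_cofactor sD !sZ sM.
have WE3 : scalar a b (W * E3) c.
  have -> : W * E3 = s (z' q) - s z * E1.
    by rewrite -!sM -sB /z' addrK.
  move=> g x x0; rewrite rhoD rhoN sz' //.
  by rewrite (scalar_mulr0 E1 sz) // mul0r subr0.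
(* [W * E3] is a nonzero scalar, so [E3] is a monomial of some shift [n];      *)
(* nothing climbs above [a], so [n = 0] and [E3] is multiplication by          *)
(* [f x = l * x ^ m]. The commutation of [E1] and [E2] with [E3] then forces   *)
(* [m = 1] or [m = -1], with [E1] of shift [- m] and [E2] of shift [m].        *)
have [n [homW homE3]] := invertible_homogeneous c0 WE3.
have kWE x : x != 0 -> kcoef a b W (- n) x * kcoef a b E3 n (tr q (- n) x) = c.
  move=> x0; rewrite -kcoef_mul // => [|i im]; last by left; exact: homW.
  by rewrite addNr (scalar_kcoef _ WE3) // eqxx mulr1.
have n0 : n = 0.
  have [lt|gt|//] := ltgtP n 0.
    have := kWE a a0; rewrite kcoef_blocked //; last by lia.
    by rewrite mul0r => e; rewrite -e eqxx in c0.
  have := kWE (tr q n a); rewrite tr_eq0 // => /(_ a0).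
  rewrite trD // addNr tr0 kcoef_blocked //.
  by rewrite mulr0 => e; rewrite -e eqxx in c0.
rewrite {n}n0 oppr0 in homW homE3 kWE.
pose f := kcoef a b E3 0.
have fW x : x != 0 -> f x * kcoef a b W 0 x = c.
  by move=> x0; rewrite mulrC -(kWE x x0) tr0.
have [l [m [l0 fE]]] : exists (l : K) (m : int),
    l != 0 /\ forall x, x != 0 -> f x = l * x ^ m.
  by apply: laurent_unit c0 _ _ fW; exact: laurent_kcoef.
have rhoE3 g x : x != 0 -> rho a b E3 g x = f x * g x.
  by move=> x0; rewrite (rho_homogeneous _ homE3) // tr0 mulrC.
have ftr i x : x != 0 -> f (tr q i x) = Q ^ (i * m) * f x.
  move=> x0; rewrite !fE ?tr_eq0 // /tr expfzMl exprz_exp mulrCA; ring.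
have f0 x : x != 0 -> f x != 0 by move=> x0; rewrite fE // mulf_neq0 ?expfz_neq0.
have kE3r u i x : x != 0 -> kcoef a b (u * E3) i x = f (tr q i x) * kcoef a b u i x.
  move=> x0; rewrite {1}/kcoef rhoM.
  rewrite (@rho_congr _ _ _ _ _ _ u _
    (fun t => f (tr q i x) * delta (tr q i x) t + (fun=> 0) t)) //.
    by rewrite operP oper_fun0 addr0.
  move=> t t0; rewrite rhoE3 // /delta addr0.
  by case: eqP => [->|]; rewrite ?mulr0.
have kE3l u i x : x != 0 -> kcoef a b (E3 * u) i x = f x * kcoef a b u i x.
  by move=> x0; rewrite {1}/kcoef rhoM rhoE3.
(* Comparing coefficients of shift [i] in [h13], with f(Q^i x) = Q^(i m) f(x), gives Q^(i m) =
   Q^-1. *)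
have k1 i x : x != 0 -> kcoef a b E1 i x != 0 -> i * m = - 1%:Z.
  move=> x0 k0; apply: exprz_eq_int; apply: (mulIf (f0 x x0)).
  rewrite -ftr //; apply: (mulIf k0); rewrite -kE3r // h13.
  by rewrite {1}/kcoef rhoZ -/(kcoef a b _ _ _) kE3l // mulrA exprN1.
have k2 i x : x != 0 -> kcoef a b E2 i x != 0 -> i * m = 1%:Z.
  move=> x0 k0; apply: exprz_eq_int; apply: (mulIf (f0 x x0)).
  rewrite -ftr //; apply: (mulIf k0); rewrite -kE3r // h23.
  rewrite {1}/kcoef rhoD sz // mul0r addr0 rhoZ -/(kcoef a b _ _ _) kE3l //.
  by rewrite mulrA expr1z.
(* Otherwise i m = -1 has no solution, so [E1] acts as 0, hence [E3] too by [h12], against [f0]. *)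
have m1 : m = 1 \/ m = - 1%:Z.
  case: (pselect (m = 1 \/ m = - 1%:Z)) => // mn1.
  have E1_0 : scalar a b E1 0.
    apply: kcoef_eq0 => i x x0; apply/eqP/negP => /negP /(k1 i x x0) im.
    have /eqP : absz (i * m) = 1%N by rewrite im.
    by rewrite abszM muln_eq1 => /andP[_ /eqP m1]; apply: mn1; lia.
  have := rhoE3 (fun=> 1) 1 (oner_neq0 _).
  rewrite h12 rhoD rhoN rhoZ (scalar_mulr0 E2 E1_0) ?oner_neq0 //.
  rewrite (scalar_mull0 E2 E1_0) ?oner_neq0 // !mul0r mulr0 subr0 mulr1 => e.
  by have := f0 1 (oner_neq0 _); rewrite -e eqxx.
have hom1 : homogeneous q_neq0 q_not_root a b E1 (- m).
  move=> i x x0 im; apply/eqP/negP => /negP /(k1 i x x0); move/eqP: im.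
  by case: m1 => ->; lia.
have hom2 : homogeneous q_neq0 q_not_root a b E2 m.
  move=> i x x0 im; apply/eqP/negP => /negP /(k2 i x x0); move/eqP: im.
  by case: m1 => ->; lia.
pose h := kcoef a b E1 (- m); pose k := kcoef a b E2 m.
have rhoE1 g x : x != 0 -> rho a b E1 g x = g (tr q (- m) x) * h x.
  by move=> x0; rewrite (rho_homogeneous _ hom1).
have rhoE2 g x : x != 0 -> rho a b E2 g x = g (tr q m x) * k x.
  by move=> x0; rewrite (rho_homogeneous _ hom2).
pose c' := Q ^+ 2 / (Q + 1).
have c'0 : c' != 0.
  by rewrite mulf_neq0 ?invr_eq0 ?(Q_neqN1 q_not_root) // !expf_neq0.
(* Evaluates [W * E3] on the constant function 1. *)
have key x : x != 0 -> (Q * (Q - 1) * (k x * h (tr q m x)) + c' * f x) * f x = c.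
  move=> x0; have := WE3 (fun=> 1) x x0.
  rewrite rhoM hW rhoD !rhoZ rhoM rhoE3 // rhoE2 // rhoE1 ?tr_eq0 //.
  rewrite rhoE3; last by rewrite !tr_eq0.
  rewrite trD // addNr tr0 rhoE3 // !mulr1 => <-.
  rewrite -/c'; ring.
(* [E2 * E1] vanishes at two opposite points, both of which lead to [a].       *)
have [t tE] := closed_sqrt (c / (c' * l ^+ 2)).
have t0 : t != 0.
  apply/eqP => e; move/eqP: tE; rewrite e expr0n /= eq_sym.
  by apply/negP; rewrite mulf_neq0 // invr_eq0 mulf_neq0 // expf_neq0.
(* By the choice of [t], the term c' f(x)^2 of [key] already equals [c] at these points. *)
have zero x : x != 0 -> x ^ m = t \/ x ^ m = - t -> k x * h (tr q m x) = 0.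
  move=> x0 xt; have := key x x0; rewrite mulrDl -[RHS]add0r => /eqP.
  have -> : c' * f x * f x = c.
    rewrite fE //.
    have -> : c' * (l * x ^ m) * (l * x ^ m) = c' * l ^+ 2 * (x ^ m) ^+ 2.
      by ring.
    have -> : (x ^ m) ^+ 2 = t ^+ 2 by case: xt => ->; rewrite ?sqrrN.
    by rewrite tE mulrC divfK // mulf_neq0 ?expf_neq0.
  rewrite (inj_eq (addIr _)) mulf_eq0 (negPf (f0 x x0)) orbF mulf_eq0.
  rewrite mulf_eq0 (negPf (Q_neq1 q_not_root)) (negPf (Q_neq0 q_neq0)) /=.
  by move/eqP.
(* As m is 1 or -1, y^m = t^(m^2) = t. *)
pose y := t ^ m.
have y0 : y != 0 by rewrite expfz_neq0.
have ym : y ^ m = t by rewrite /y exprz_exp; case: m1 => ->; rewrite expr1z.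
have Nym : (- y) ^ m = - t.
  by case: m1 ym => -> ; rewrite ?expr1z ?exprN1 ?invrN => ->.
have NyE : - y != y.
  rewrite -subr_eq0 -opprD oppr_eq0 -mulr2n -mulr_natl mulf_neq0 //.
have gen S : preserves S (rho a b E1) -> preserves S (rho a b E2) ->
    forall u, preserves S (rho a b u).
  move=> S1 S2 u; have [v <-] := s_surj u; exact: preserves_gen.
have r1 := zero y y0 (or_introl ym).
have Ny0 : - y != 0 by rewrite oppr_eq0.
have r2 := zero (- y) Ny0 (or_intror Nym).
(* For m = 1, [E2] climbs and [E1] descends, so both [y] and [- y] equal [a]. For m = -1 the roles
   are exchanged and the crossing starts one step lower, at x/Q. *)
case: m1 => m1; rewrite m1 in rhoE1 rhoE2 r1 r2.
  have cr x : x != 0 -> k x * h (tr q 1 x) = 0 -> x = a.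
    by move=> x0; apply: (crossing x0 _ rhoE2 rhoE1) => S S2 S1; exact: gen.
  by case/eqP: NyE; rewrite (cr _ Ny0 r2) (cr _ y0 r1).
rewrite opprK in rhoE1.
have cr x : x != 0 -> k x * h (tr q (- 1%:Z) x) = 0 -> tr q (- 1%:Z) x = a.
  move=> x0 e; apply: (crossing _ gen rhoE1 rhoE2); first by rewrite tr_eq0.
  by rewrite trD // subrr tr0 mulrC.
case/eqP: NyE; have := cr _ y0 r1; rewrite -(cr _ Ny0 r2) /tr.
by move/(mulfI (expfz_neq0 _ (Q_neq0 q_neq0))).
Qed.

End SurjectionAtZero.

(** * The image of z under an automorphism *)

Section Automorphism.
Variables (K : closedFieldType) (q : K).
Hypotheses (q_neq0 : q != 0)
  (q_not_root : forall n : nat, (0 < n)%N -> q ^+ n != 1)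
  (two_neq0 : 2%:R != 0 :> K).

Local Notation Q := (q ^+ 2).
Local Notation rho := (rho q_neq0 q_not_root).
Local Notation scalar := (scalar q_neq0 q_not_root).
Implicit Types (u v : Uplus q) (a b c x : K).

(** In commuting scalars the first Serre relation is a nonzero multiple of f(e1)^2 f(e2) = 0, which
    forces f(e1) f(e2) = 0 and kills [e3], then [z]. *)
Lemma character_z (f : {lrmorphism Uplus q -> K^o}) : f z = 0.
Proof.
have fM u v : f (u * v) = f u * f v by exact: rmorphM.
have fZ k u : f (k *: u) = k * f u by exact: linearZZ.
have fB u v : f (u - v) = f u - f v by exact: raddfB.
have fe3 : f e3 = f e1 * f e2 - Q * (f e2 * f e1) by rewrite /e3 fB fZ !fM.
have s12 : f e1 * (f e1 * f e2 - Q * (f e2 * f e1))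
           - Q^-1 * ((f e1 * f e2 - Q * (f e2 * f e1)) * f e1) = 0.
  by rewrite -fe3 -!fM -fZ -fB e1e3 // addrN raddf0.
have e0 : f e1 * f e2 = 0.
  move/eqP: s12.
  rewrite (_ : _ - _ = f e1 * (f e1 * f e2) * (- (Q - 1) ^+ 2 / Q));
    last by field.
  rewrite mulf_eq0 orbC mulf_eq0 oppr_eq0 invr_eq0 !expf_eq0 /= orbC.
  rewrite (negPf (Q_neq1 q_not_root)) (negPf q_neq0) !orbF mulf_eq0.
  by case/orP => /eqP; [move=> ->; rewrite mul0r |].
have f3 : f e3 = 0 by rewrite fe3 (mulrC (f e2)) e0 mulr0 subr0.
by rewrite /z fB fZ !fM f3 mulr0 mul0r mulr0 subr0.
Qed.

Lemma augmentation_exists :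
  exists f : {lrmorphism Uplus q -> K^o}, f e1 = 0 /\ f e2 = 0.
Proof.
apply: Uplus_lift.
  by rewrite /serre12 !(mulr0, mul0r) scaler0 subr0 addr0.
by rewrite /serre21 !(mulr0, mul0r) !scaler0 !subr0 addr0.
Qed.

Lemma eval2_00 (A : algType K) (P : {poly {poly K}}) :
  eval2 (0 : A) 0 P = (P.[0%:P].[0])%:A.
Proof.
rewrite /eval2 !horner_coef0 coef_map /=.
by elim/poly_ind: (P`_0) => [|p c _];
  rewrite ?raddf0 ?coef0 ?scale0r // rmorphD rmorphM /= horner_algX mulr0
    horner_algC add0r coefD coefMX coefC add0r.
Qed.

Lemma ideal_gen_preim (s : {lrmorphism Uplus q -> Uplus q}) :
  ideal_gen [set z : Uplus q] (s z) ->
  forall u, ideal_gen [set z : Uplus q] u -> ideal_gen [set z : Uplus q] (s u).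
Proof.
move=> sz u; have [I0 ID IL IR] := ideal_gen_ideal [set z : Uplus q].
move=> /(_ [set u | ideal_gen [set z : Uplus q] (s u)]); apply.
split; last by move=> _ ->.
split=> [|v v' hv hv'|v v' hv|v v' hv] /=.
- by rewrite raddf0.
- by rewrite raddfD; exact: ID.
- by rewrite rmorphM; exact: IL.
- by rewrite rmorphM; exact: IR.
Qed.

Section TwoAutomorphisms.
Variables s t : {lrmorphism Uplus q -> Uplus q}.
Hypotheses (sK : cancel s t) (tK : cancel t s).

Let morph_central (r r' : {lrmorphism Uplus q -> Uplus q}) u : cancel r' r ->
  (forall v, u * v = v * u) -> forall v, r u * v = v * r u.
Proof. by move=> rK uC v; rewrite -[v]rK -!rmorphM uC. Qed.

Lemma image_z_neq0 (P : {poly {poly K}}) a b :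
  s z = eval2 (z' q) z P -> a != 0 -> P.[a%:P].[b] != 0.
Proof.
move=> sz a0; apply/eqP => P0.
have zC := z_central q_neq0 (K := K).
have z'C := z'_central q_neq0 q_not_root.
have [P' sz'] := center_eval2 q_neq0 q_not_root (morph_central tK z'C).
have [F tz] := center_eval2 q_neq0 q_not_root (morph_central sK zC).
have hz := scalar_z q_neq0 q_not_root a b.
have hz' := scalar_z' q_neq0 q_not_root a b.
have ssz : scalar a b (s z) 0.
  by rewrite -P0 sz; exact: scalar_eval2.
have ssz' : scalar a b (s (z' q)) P'.[a%:P].[b].
  by rewrite sz'; exact: scalar_eval2.
have [c0|c0] := eqVneq P'.[a%:P].[b] 0; last first.
  by apply: (no_surjection_at_zero two_neq0 _ a0 c0 ssz ssz') => u; exists (t u).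
rewrite c0 in ssz'.
(* [z = s (t z)] is [F] evaluated at [s z'] and [s z], which both act as 0, so its scalar [a] is the
   constant term of [F]. *)
have aF : a = F.[0%:P].[0].
  apply: (scalar_uniq hz); rewrite -[z in scalar _ _ z]tK tz eval2_morph.
  exact: scalar_eval2.
have [f [f1 f2]] := augmentation_exists.
have fM u v : f (u * v) = f u * f v by exact: rmorphM.
have fD u v : f (u + v) = f u + f v by exact: raddfD.
have fB u v : f (u - v) = f u - f v by exact: raddfB.
have fZ k u : f (k *: u) = k * f u by exact: linearZZ.
have fz' : f (z' q) = 0.
  have f3 : f e3 = 0 by rewrite /e3 fB fZ !fM f1 mulr0 mul0r mulr0 subr0.
  by rewrite /z' fD !fM f1 f3 !mulr0 addr0.
(* The characters [f] and [f \o t] kill [z], and [f] kills [z'], so this constant term is also 0. *)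
have : f (t z) = 0 by exact: (character_z (f \o t)).
rewrite tz eval2_morph character_z fz' eval2_00 -aF => /eqP.
by rewrite scaler_eq0 oner_eq0 orbF (negPf a0).
Qed.

Lemma image_z_ideal : ideal_gen [set z : Uplus q] (s z).
Proof.
have zC := z_central q_neq0 (K := K).
have [P sz] := center_eval2 q_neq0 q_not_root (morph_central tK zC).
have Pn0 a b := image_z_neq0 (a := a) b sz.
have [P1 [c PE]] : exists (P1 : {poly {poly K}}) (c : {poly K}),
    P = P1 * 'X + c%:P.
  elim/poly_ind: (P) => [|P1 c _]; last by exists P1, c.
  by exists 0, 0; rewrite mul0r addr0.
have [c0|c0] := eqVneq c 0.
  have [_ _ IL _] := ideal_gen_ideal [set z : Uplus q].
  rewrite sz PE c0 eval2_step raddf0 addr0; apply: IL.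
  exact: ideal_gen_sub.
(* Where c(b) != 0, P(., b) has no root at all, hence is constant. Multiplying by [c] makes the
   vanishing hold at every b. *)
have coefP i : P`_i.+1 = 0.
  suff /eqP : P`_i.+1 * c = 0 by rewrite mulf_eq0 (negPf c0) orbF => /eqP.
  apply: (poly_eq0 q_neq0 q_not_root) => b _; rewrite hornerM.
  have [->|cb] := eqVneq c.[b] 0; first by rewrite mulr0.
  pose pb := map_poly (horner_eval b) P.
  have pbE a : pb.[a] = P.[a%:P].[b].
    rewrite /pb -[X in _.[X]](hornerC a b) -[_.[b]]/(horner_eval b _).
    by rewrite horner_map.
  have /eqP pb1 : size pb == 1%N.
    apply/negPn/negP => /closed_rootP[a]; rewrite /root pbE.
    have [->|a0] := eqVneq a 0; last by rewrite (negPf (Pn0 a b a0)).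
    by rewrite PE hornerMXaddC mulr0 add0r (negPf cb).
  have : pb`_i.+1 = 0 by rewrite nth_default // pb1.
  by rewrite coef_map /= /horner_eval => ->; rewrite mul0r.
have {coefP} PC : P = c%:P.
  apply/polyP => -[|i]; last by rewrite coefP coefC.
  by rewrite PE coefD coefMX coefC add0r.
(* A root b of [c] would give P(1, b) = 0. *)
have /eqP/size_poly1P[k k0 ck] : size c = 1%N.
  apply/eqP/negPn/negP => /closed_rootP[b]; rewrite /root => /eqP cb.
  by have := Pn0 1 b (oner_neq0 _); rewrite PC hornerC cb eqxx.
have zk : z = k%:A :> Uplus q.
  rewrite -[z]sK sz PC ck /eval2 map_polyC hornerC /= horner_algC.
  by rewrite linearZ rmorph1.
(* In the representation with a = 0, [z] acts as 0 and cannot be the nonzero scalar [k]. *)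
have := scalar_uniq (scalar_z q_neq0 q_not_root 0 0).
rewrite zk => /(_ k) e; case/eqP: k0; rewrite -e //.
exact: scalarC.
Qed.

End TwoAutomorphisms.

(** The inclusion of s(<z>) in <z>, applied to the inverse automorphism, gives the reverse
    inclusion. *)
Theorem Aut_z_eq : Aut_z q = algAut (Uplus q).
Proof.
apply/seteqP; split=> [s []//|s sA]; split=> //.
have [[t sK tK] [f sf]] := sA.
have [_ [g tg]] := algAut_inv sA sK tK.
subst s t; apply/seteqP; split=> [_ [u Iu <-]|u Iu].
  exact: ideal_gen_preim (image_z_ideal sK tK) _ Iu.
exists (g u) => //; exact: ideal_gen_preim (image_z_ideal tK sK) _ Iu.
Qed.

End Automorphism.

Theorem proposition4p3 (R : realType) (q : R[i])
    (q_neq0 : q != 0)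
    (q_not_root : forall n : nat, (0 < n)%N -> q ^+ n != 1) :
  Aut_z q = algAut (Uplus q).
Proof.
by apply: Aut_z_eq => //; rewrite Num.Theory.pnatr_eq0.
Qed.
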